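(* For integers $k>i\geq 1$, $$\sum_{N_{1}\geq \cdots\geq N_{k-1}\geq 0}\frac{(-q^{2-2N_1};q^2)_{N_1-1}(-q^{1-2N_1};q^2)_{N_1}\,q^{2(N^2_{1}+\cdots+N^2_{k-1}+N_{i+1}+\cdots+N_{k-1})}(1+q^{2N_i})}{(q^2;q^2)_{N_1-N_2}\cdots(q^2;q^2)_{N_{k-2}-N_{k-1}}(q^{4};q^{4})_{N_{k-1}}}=\frac{(-q;q)_\infty(q^{2i-1},q^{4k-3-2i},q^{4k-4};q^{4k-4})_\infty}{(q;q)_\infty},$$ where the sum is over integers $N_1\ge\cdots\ge N_{k-1}\ge0$.
   Context: $(a;q)_\infty=\prod_{j\ge0}(1-aq^j)$ and $(a;q)_n=(a;q)_\infty/(aq^n;q)_\infty$ for every integer $n$ (in particular, when $N_1=0$ the factor $(-q^{2};q^2)_{-1}$ equals $1/2$). $(a_1,\dots,a_r;q)_\infty=(a_1;q)_\infty\cdots(a_r;q)_\infty$. The sum $N_{i+1}+\cdots+N_{k-1}$ is empty (equal to $0$) when $i=k-1$, and for $k=2$ the denominator is just $(q^4;q^4)_{N_1}$. The identity may be read as one of formal power series in $q$, or for $|q|<1$. *)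

(* Defs.v *)
From HB Require Import structures.
From mathcomp Require Import all_boot all_order all_algebra.
From mathcomp Require Import finmap complex.
From mathcomp Require Import all_classical all_reals all_analysis.
From mathcomp.analysis Require Import showcase.summability.

Set Implicit Arguments.
Unset Strict Implicit.
Unset Printing Implicit Defensive.

Import Order.TTheory GRing.Theory Num.Theory.
Import numFieldNormedType.Exports.
Local Open Scope classical_set_scope.
Local Open Scope ring_scope.

Section QPochhammer.
Variable K : numFieldType.
Implicit Types (a q : K) (n : int).

Definition qpoch_inf a q : K := lim ((\prod_(j < m) (1 - a * q ^+ j)) @[m --> \oo]).

(* For every integer n, negative ones included: (a; q)_n is the quotient
   (a; q)_oo / (a q^n; q)_oo, not a finite product. *)
Definition qpoch a q n : K := qpoch_inf a q / qpoch_inf (a * q ^ n) q.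

End QPochhammer.

(* Unconditional summation: convergence of the net of all finite partial sums. *)
Definition has_sum (I : choiceType) (K : numFieldType) (f : I -> K) (l : K) : Prop :=
  partial_sum f @ totally --> l.

Definition chain (m : nat) := {N : m.-tuple nat | sorted geq N}.

(* Indices are 1-based: [part N j] is N_j for 1 <= j <= m. *)
Definition part (m : nat) (N : chain m) (j : nat) : nat := nth 0%N (val N) j.-1.

(* Main.v *)
Require Import Defs.
From HB Require Import structures.
From mathcomp Require Import all_boot all_order all_algebra.
From mathcomp Require Import ring lra zify.
From mathcomp Require Import finmap complex.
From mathcomp Require Import all_classical all_reals all_analysis.
From mathcomp.analysis Require Import showcase.summability.

(* Put p = q^2. Reversing the two negative-index factors turns the summand into
   q^(N_1) (-q; q)_(2 N_1 - 1) times a product of Bailey-chain weights in base p.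
   The Bailey pair (relative to p) of 1 / (p^2; p^2)_n, moved along the chain and
   then lowered to a pair relative to 1 by the factor 1 + p^(N_i), expresses the
   sum over N_2, ..., N_(k-1) as a combination of the kernels
   1 / ((p; p)_(N_1 - r) (p; p)_(N_1 + r)). The remaining sum over N_1 is a q-Gauss
   sum, evaluated as a limit of partial sums, and the sum over r that is left is
   the theta series of the Jacobi triple product. *)

Set Implicit Arguments.
Unset Strict Implicit.
Unset Printing Implicit Defensive.

Import Order.TTheory GRing.Theory Num.Theory.
Import numFieldNormedType.Exports.
Import ComplexField.Normc.
Local Open Scope classical_set_scope.
Local Open Scope ring_scope.

(** * Finite identities *)

(** The sum over r becomes a theta series because of a cancellation. Shifted by n = r + u, the sum
    over N_1 = n is a q-Gauss series in base p with numerator parameters -p^r and -q p^r,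
    denominator parameter p^(2r+1) and the critical argument q. The n-sum depends on r in a
    complicated way, but multiplied by the factor 1 + p^r, which the descent to a pair relative to 1
    leaves behind, it equals q^r (-q; q)_oo / (q; q)_oo. The quadratic exponent collects one p^(r^2
    + r) for each step below N_i and one p^(r^2) for each of the i - 1 steps above it. The obstacle
    is that q-Gauss is an infinite sum. The certificate telescopes a difference in r, not the sum
    itself; iterated over r, it rewrites the partial sum as a finite sum of Rogers-Szego type, of
    which only the limit is evaluated. Exchanges of summation therefore concern finite sums cut at
    N_1 <= M, and limits in M are then taken by dominated convergence. *)

Definition poch (F : comNzRingType) (a p : F) (n : nat) : F :=
  \prod_(j < n) (1 - a * p ^+ j).

Lemma poch0 (F : comNzRingType) (a p : F) : poch a p 0 = 1.
Proof. exact: big_ord0. Qed.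

Lemma pochS (F : comNzRingType) (a p : F) n :
  poch a p n.+1 = poch a p n * (1 - a * p ^+ n).
Proof. exact: big_ord_recr. Qed.

Lemma pochSl (F : comNzRingType) (a p : F) n :
  poch a p n.+1 = (1 - a) * poch (a * p) p n.
Proof.
rewrite /poch big_ord_recl expr0 mulr1; congr (_ * _).
by apply: eq_bigr => j _; rewrite exprS mulrA.
Qed.

Lemma pochD (F : comNzRingType) (a p : F) m n :
  poch a p (m + n) = poch a p m * poch (a * p ^+ m) p n.
Proof.
rewrite /poch big_split_ord; congr (_ * _).
by apply: eq_bigr => j _; rewrite /= exprD mulrA.
Qed.

Lemma poch_sqr_split (F : comNzRingType) (a q : F) n :
  poch a q n.*2.+1 = poch a (q ^+ 2) n.+1 * poch (a * q) (q ^+ 2) n.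
Proof.
elim: n => [|n IH]; first by rewrite !pochS !poch0 mulr1.
rewrite doubleS (pochS _ _ n.*2.+2) (pochS _ _ n.*2.+1) IH.
rewrite (pochS _ _ n.+1) (pochS (a * q)).
have -> : q ^+ n.*2.+1 = q * q ^+ 2 ^+ n by rewrite -exprM mul2n exprS.
have -> : q ^+ n.*2.+2 = q ^+ 2 ^+ n.+1 by rewrite -exprM mul2n doubleS.
ring.
Qed.

Lemma poch_neq0 (F : idomainType) (a p : F) n :
  (forall j, a * p ^+ j != 1) -> poch a p n != 0.
Proof. by move=> nz; apply/prodf_neq0 => j _; rewrite subr_eq0 eq_sym. Qed.

(** Each factor turns over as 1 - z/p^j = -(z/p^j) (1 - p^j/z) for 1 <= j <= n; the powers of p add
    up to the binomial exponent. *)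
Lemma poch_rev (F : fieldType) (z p : F) n : z != 0 -> p != 0 ->
  poch (z / p ^+ n) p n = (- z) ^+ n / p ^+ 'C(n.+1, 2) * poch (p / z) p n.
Proof.
move=> z_neq0 p_neq0; elim: n => [|n IH].
  by rewrite !poch0 !expr0 divr1 mulr1.
rewrite pochSl pochS; have -> : z / p ^+ n.+1 * p = z / p ^+ n.
  by rewrite exprS; field; rewrite p_neq0 expf_neq0.
rewrite IH (binS n.+1) bin1 (exprD _ 'C(n.+1, 2)) (exprS p) (exprS (- z)).
have pn : p ^+ n != 0 by rewrite expf_neq0.
have pb : p ^+ 'C(n.+1, 2) != 0 by rewrite expf_neq0.
by field; rewrite pn pb p_neq0 z_neq0.
Qed.

(** Plain sequences, capped by [M] at the head, so that sums over chains can be peeled off one entry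
    at a time by induction on the length. *)
Fixpoint chains m M : seq (seq nat) :=
  if m is m'.+1 then [seq n :: s | n <- iota 0 M.+1, s <- chains m' n]
  else [:: [::]].

Lemma mem_chains m M s : (s \in chains m M) = (size s == m) && path geq M s.
Proof.
elim: m M s => [|m IH] M s; first by rewrite inE; case: s.
apply/allpairsPdep/idP => [[n [s' []]]|].
  rewrite mem_iota IH add0n ltnS /= => le_nM /andP[/eqP sz ps] ->.
  by rewrite /= sz eqxx le_nM.
case: s => [//|n s] /andP[sz /andP[le_nM ps]]; exists n, s.
have ps' : path geq n s by [].
by rewrite mem_iota add0n ltnS [(n <= M)%N]le_nM IH ps' -eqSS [_ == _]sz.
Qed.

Lemma chains_uniq m M : uniq (chains m M).
Proof.
elim: m M => [//|m IH] M; apply: allpairs_uniq_dep => [|n _|].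
- exact: iota_uniq.
- exact: IH.
by move=> [n s] [n' s'] _ _ /= [-> ->].
Qed.

Lemma big_chainsS (R : Type) (idx : R) (op : Monoid.law idx) m M (G : seq nat -> R) :
  \big[op/idx]_(s <- chains m.+1 M) G s
  = \big[op/idx]_(n < M.+1) \big[op/idx]_(s <- chains m n) G (nat_of_ord n :: s).
Proof.
rewrite -[chains _ _]/[seq n :: s | n <- iota 0 M.+1, s <- chains m n].
rewrite big_allpairs_dep -(big_mkord predT
  (fun n => \big[op/idx]_(s <- chains m n) G (n :: s))) /index_iota subn0 //.
Qed.

(** * Bailey kernels in base p, the chain and lattice steps, and q-binomial sums *)

Section FiniteIdentities.
Variables (F : fieldType) (p : F).
Hypothesis p_neq0 : p != 0.
Hypothesis p_nonroot : forall n, p ^+ n.+1 != 1.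

Local Notation qf := (poch p p).

Lemma one_sub_pow n : 1 - p * p ^+ n != 0.
Proof. by rewrite -exprS subr_eq0 eq_sym. Qed.

Lemma qf_neq0 n : qf n != 0.
Proof. by apply/prodf_neq0 => j _; apply: one_sub_pow. Qed.

Lemma qfVS n : (qf n)^-1 = (1 - p * p ^+ n) / qf n.+1.
Proof. by rewrite pochS invfM mulrCA divff ?mulr1 ?one_sub_pow. Qed.

(* [1 / (p; p)_k] vanishes for [k < 0]; the guard is there because [n - r] truncates. *)
Definition qfVB n r : F := if (r <= n)%N then (qf (n - r))^-1 else 0.

Lemma qfVB_gt n r : (n < r)%N -> qfVB n r = 0.
Proof. by move=> lt_nr; rewrite /qfVB leqNgt lt_nr. Qed.

Lemma qfVBSS n r : qfVB n.+1 r.+1 = qfVB n r.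
Proof. by []. Qed.

(** This is (p; p)_(n-r) = (p; p)_(n-r-1) (1 - p^(n-r)), scaled so that it also holds in the
    truncated range: at r = n the factor p^r - p^n supplies the zero. Certificates can then be
    checked by [field] without splitting on r <= n. *)
Lemma qfVB_recl n r : p ^+ r * qfVB n r.+1 = (p ^+ r - p ^+ n) * qfVB n r.
Proof.
have [le_nr|lt_rn] := leqP n r.
  rewrite qfVB_gt // mulr0; have [->|ne] := eqVneq r n.
    by rewrite subrr mul0r.
  by rewrite qfVB_gt ?mulr0 // ltn_neqAle eq_sym ne.
rewrite /qfVB lt_rn (ltnW lt_rn) -(subnSK lt_rn) qfVS mulrA; congr (_ / _).
by rewrite mulrBr mulr1 -exprS -exprD subnSK // subnKC // ltnW.
Qed.

(** The kernel of a Bailey pair relative to p^a, used only for a = 0 and a = 1. For a = 1 the usual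
    constant 1 - p is left out of the normalisation. *)
Definition bker a n r : F := qfVB n r / qf (n + r + a).

Lemma bker_gt a n r : (n < r)%N -> bker a n r = 0.
Proof. by move=> lt_nr; rewrite /bker qfVB_gt // mul0r. Qed.

Lemma bker1_bottom n :
  \sum_(r < n.+1) (-1) ^+ r * p ^+ (r ^ 2) * (1 - p * p ^+ r ^+ 2) * bker 1 n r
  = (poch (p ^+ 2) (p ^+ 2) n)^-1.
Proof.
have nz m : 1 - p ^+ 2 * (p ^+ 2) ^+ m != 0.
  by rewrite -exprS -exprM mulnS addSn subr_eq0 eq_sym.
elim: n => [|n IH].
  rewrite big_ord1 /bker /qfVB /= !poch0 pochS poch0 /=.
  rewrite !expr0 expr1n !mul1r mulr1 invr1 mul1r divff //.
  by have := one_sub_pow 0; rewrite expr0 mulr1.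
pose t m r := (-1) ^+ r * p ^+ (r ^ 2) * (1 - p * p ^+ r ^+ 2) * bker 1 m r.
have t0 : t n n.+1 = 0 by rewrite /t bker_gt // mulr0.
(* [G] is the Wilf-Zeilberger mate of [t]. *)
pose G r := p * p ^+ n * (p ^+ r - (p ^+ r)^-1) * ((-1) ^+ r * p ^+ (r ^ 2))
  * (qfVB n.+1 r / qf (n + r).+1).
have E r : (1 - p ^+ 2 * (p ^+ 2) ^+ n) * t n.+1 r - t n r = G r.+1 - G r.
  rewrite /t /G /bker !addn1 qfVBSS addSn addnS !(qfVS (n + r).+1).
  have -> : p ^+ (r.+1 ^ 2) = p ^+ (r ^ 2) * (p * (p ^+ r) ^+ 2).
    by rewrite -exprM -exprS -exprD; congr (_ ^+ _); lia.
  have -> : (p ^+ 2) ^+ n = (p ^+ n) ^+ 2 by rewrite exprAC.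
  rewrite (exprS _ (n + r)) (exprS _ r) (exprS (-1)) exprD.
  have zr : p ^+ r != 0 by rewrite expf_neq0.
  have -> : qfVB n r = (p ^+ r - p * p ^+ n) * qfVB n.+1 r / p ^+ r.
    by rewrite -exprS -qfVB_recl mulrAC divff ?mul1r.
  have := qf_neq0 (n + r).+2.
  move: (qfVB n.+1 r) (qf (n + r).+2) ((-1) ^+ r) (p ^+ (r ^ 2)) (p ^+ n) (p ^+ r) zr.
  move=> c d s u x y zy zd; field.
  by rewrite zd zy.
have tel : (1 - p ^+ 2 * (p ^+ 2) ^+ n) * (\sum_(r < n.+2) t n.+1 r)
            = \sum_(r < n.+1) t n r.
  have -> : \sum_(r < n.+1) t n r = \sum_(r < n.+2) t n r.
    by rewrite [RHS]big_ord_recr /= t0 addr0.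
  apply/eqP.
  rewrite -subr_eq0 mulr_sumr -sumrB; under eq_bigr do rewrite E.
  (* Both boundary terms vanish: [qfVB n.+1 n.+2] is zero at the upper end, and p^r - p^(-r) is zero
     at r = 0. *)
  rewrite -(big_mkord predT (fun r => G r.+1 - G r)) telescope_sumr // /G.
  by rewrite qfVB_gt // expr0 invr1 subrr !(mul0r, mulr0) subrr.
rewrite /t IH in tel; rewrite pochS invfM -tel mulrAC divff // mul1r //.
Qed.

(* Induction via [(1 - p^(N+1)) V(N+1, c) = V(N, c+1)], where [V(N, c)] is the sum;
   [h] collects the terms that telescope. *)
Lemma q_vandermonde N c :
  \sum_(u < N.+1) p ^+ (u ^ 2 + c * u) * qfVB N u / (qf u * qf (u + c))
  = (qf N * qf (N + c))^-1.
Proof.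
elim: N c => [|N IH] c.
  by rewrite big_ord1 muln0 expr0 mul1r /qfVB /= poch0 invr1 !mul1r.
pose b u := p ^+ (u ^ 2 + c.+1 * u) * qfVB N u / (qf u * qf (u + c.+1)).
pose h u := if u is v.+1 then
  p * p ^+ c * p ^+ (v ^ 2 + c.+2 * v) * qfVB N v / (qf v * qf (v + c.+1))
  else 0.
have E u : (1 - p * p ^+ N) *
    (p ^+ (u ^ 2 + c * u) * qfVB N.+1 u / (qf u * qf (u + c)))
    = b u - (h u.+1 - h u).
  (* The first part lowers [N] through [qfVB_recl]; the second cancels the last factor of [qf u] and
     so shifts u. *)
  have -> : 1 - p * p ^+ N = (p ^+ u - p ^+ N.+1) + (1 - p ^+ u).
    by rewrite exprS; ring.
  have first : (p ^+ u - p ^+ N.+1) *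
    (p ^+ (u ^ 2 + c * u) * qfVB N.+1 u / (qf u * qf (u + c))) = b u - h u.+1.
    rewrite mulrA mulrCA -qfVB_recl qfVBSS /b /h.
    rewrite !invfM (qfVS (u + c)) addnS.
    have -> : p ^+ (u ^ 2 + c.+1 * u) = p ^+ (u ^ 2 + c * u) * p ^+ u.
      by rewrite -exprD; congr (_ ^+ _); lia.
    have -> : p ^+ (u ^ 2 + c.+2 * u) = p ^+ (u ^ 2 + c * u) * p ^+ u * p ^+ u.
      by rewrite -!exprD; congr (_ ^+ _); lia.
    by rewrite (exprD _ u c); ring.
  rewrite mulrDl first opprB addrCA addrC; congr (_ + _).
  case: u {first} => [|u]; first by rewrite expr0 subrr mul0r.
  rewrite /h qfVBSS addSn addnS pochS exprS.
  have -> : p ^+ (u.+1 ^ 2 + c * u.+1) = p * p ^+ c * p ^+ (u ^ 2 + c.+2 * u).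
    by rewrite -exprS -exprD; congr (_ ^+ _); lia.
  by field; rewrite one_sub_pow !qf_neq0.
have lead : (1 - p * p ^+ N) * (\sum_(u < N.+2)
    p ^+ (u ^ 2 + c * u) * qfVB N.+1 u / (qf u * qf (u + c)))
    = (qf N * qf (N + c.+1))^-1.
  rewrite mulr_sumr; under eq_bigr do rewrite E.
  rewrite sumrB -(big_mkord predT (fun u => h u.+1 - h u)) telescope_sumr //.
  by rewrite -IH big_ord_recr /b /= qfVB_gt // !(mulr0, mul0r) subr0 addr0 subr0.
apply: (mulfI (one_sub_pow N)); rewrite lead pochS addSn addnS.
have := one_sub_pow N; have := qf_neq0 N; have := qf_neq0 (N + c).+1.
by move=> z1 z2 z3; field; rewrite z1 z2 z3.
Qed.

(** Bailey's lemma with both free parameters sent to infinity. After the shift m = r + u it is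
    [q_vandermonde] with N = n - r and c = 2r + a. *)
Lemma bker_chain a n r :
  \sum_(m < n.+1) p ^+ (m ^ 2 + a * m) / qf (n - m) * bker a m r
  = p ^+ (r ^ 2 + a * r) * bker a n r.
Proof.
have [lt_nr|le_rn] := ltnP n r.
  rewrite bker_gt // mulr0 big1 // => m _.
  by rewrite bker_gt ?mulr0 // (leq_trans _ lt_nr) // ltn_ord.
rewrite -(big_mkord predT
  (fun m => p ^+ (m ^ 2 + a * m) / qf (n - m) * bker a m r)).
rewrite (big_cat_nat _ (leqW le_rn)) //= big_nat big1 ?add0r; last first.
  by move=> m /andP[_ lt_mr]; rewrite bker_gt ?mulr0.
rewrite -{1}[r]add0n big_addn subSn // big_mkord.
have := q_vandermonde (n - r) (r.*2 + a).
have -> : (n - r + (r.*2 + a) = n + r + a)%N by lia.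
rewrite /bker [X in _ * (X / _)]/qfVB le_rn -invfM => <-; rewrite mulr_sumr.
apply: eq_bigr => u _; have le_u : (u <= n - r)%N by rewrite -ltnS.
rewrite /qfVB leq_addl le_u addnK.
have -> : (u + r + r + a = u + (r.*2 + a))%N by lia.
have -> : (n - (u + r) = n - r - u)%N by lia.
have -> : p ^+ ((u + r) ^ 2 + a * (u + r))
    = p ^+ (r ^ 2 + a * r) * p ^+ (u ^ 2 + (r.*2 + a) * u).
  by rewrite -exprD; congr (_ ^+ _); lia.
by rewrite invfM !mulrA.
Qed.

(** The Bailey-lattice step from p down to 1. Cleared of denominators it reads (1 + p^n)(1 -
    p^(2r+1)) = (1 + p^r)(1 - p^(n+r+1)) - (1 + p^(r+1))(p^r - p^n). *)
Lemma bker_lattice n r :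
  (1 + p ^+ n) * ((1 - p * p ^+ r ^+ 2) * bker 1 n r)
  = (1 + p ^+ r) * bker 0 n r - p ^+ r * (1 + p ^+ r.+1) * bker 0 n r.+1.
Proof.
rewrite /bker !addn0 addn1 addnS (qfVS (n + r)) (exprS _ r) (exprD _ n).
have pr_neq0 : p ^+ r != 0 by rewrite expf_neq0.
have -> : qfVB n r.+1 = (p ^+ r - p ^+ n) * qfVB n r / p ^+ r.
  by rewrite -qfVB_recl mulrAC divff ?mul1r.
by field; rewrite pr_neq0 qf_neq0.
Qed.

Lemma bker_widen a (G : nat -> F) m n : (m <= n)%N ->
  \sum_(r < m.+1) G r * bker a m r = \sum_(r < n.+1) G r * bker a m r.
Proof.
move=> le_mn; rewrite (big_ord_widen n.+1 (fun r => G r * bker a m r)) //.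
rewrite big_mkcond; apply: eq_bigr => r _; case: ltnP => // lt_mr.
by rewrite bker_gt ?mulr0.
Qed.

Lemma bker_chain_sum a (G : nat -> F) n :
  \sum_(m < n.+1) p ^+ (m ^ 2 + a * m) / qf (n - m)
    * (\sum_(r < m.+1) G r * bker a m r)
  = \sum_(r < n.+1) G r * p ^+ (r ^ 2 + a * r) * bker a n r.
Proof.
transitivity (\sum_(m < n.+1) \sum_(r < n.+1)
    G r * (p ^+ (m ^ 2 + a * m) / qf (n - m) * bker a m r)).
  apply: eq_bigr => m _; rewrite (@bker_widen _ _ _ n) -1?ltnS // mulr_sumr.
  by apply: eq_bigr => r _; rewrite mulrCA.
rewrite exchange_big; apply: eq_bigr => r _ /=.
by rewrite -mulr_sumr bker_chain mulrA.
Qed.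

(** Summation by parts on [bker_lattice]: the second kernel at r - 1 joins the first at r, and both
    carry the factor 1 + p^r. The shifted term left at the top has a zero kernel. *)
Lemma bker_lattice_sum (G : nat -> F) n :
  (1 + p ^+ n) * (\sum_(r < n.+1) G r * (1 - p * p ^+ r ^+ 2) * bker 1 n r)
  = \sum_(r < n.+1)
      (1 + p ^+ r) * (G r - (if nat_of_ord r is t.+1 then p ^+ t * G t else 0))
      * bker 0 n r.
Proof.
pose h r := if r is t.+1
  then p ^+ t * (1 + p ^+ t.+1) * G t * bker 0 n t.+1 else 0.
apply/eqP; rewrite -subr_eq0 mulr_sumr -sumrB.
have E (r : 'I_n.+1) : true -> (1 + p ^+ n) * (G r * (1 - p * p ^+ r ^+ 2) * bker 1 n r)
  - (1 + p ^+ r) * (G r - (if nat_of_ord r is t.+1 then p ^+ t * G t else 0))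
      * bker 0 n r = - (h r.+1 - h r).
  move=> _; rewrite -[G r * _ * _]mulrA mulrCA bker_lattice /h.
  by case: (nat_of_ord r) => [|t]; ring.
rewrite (eq_bigr _ E) sumrN -(big_mkord predT (fun r => h r.+1 - h r)).
by rewrite telescope_sumr // /h bker_gt // mulr0 subr0 oppr0.
Qed.

Fixpoint chain_tail n s : F :=
  if s is m :: s' then p ^+ (m ^ 2 + m) / qf (n - m) * chain_tail m s'
  else (poch (p ^+ 2) (p ^+ 2) n)^-1.

(* The inner summand after [N_1 = n] has been fixed, [s] listing [N_2, N_3, ..];
   the factor [1 + p^(N_i)] belongs to the entry reached after [i] steps. *)
Fixpoint chain_term i n s : F :=
  if i is i'.+1 then
    if s is m :: s' then p ^+ (m ^ 2) / qf (n - m) * chain_term i' m s' else 0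
  else (1 + p ^+ n) * chain_tail n s.

Lemma chain_tailE n s :
  chain_tail n s = p ^+ (\sum_(0 <= j < size s) (nth 0 s j ^ 2 + nth 0 s j))%N
    / ((\prod_(0 <= j < size s) qf (nth 0 (n :: s) j - nth 0 s j)%N)
       * poch (p ^+ 2) (p ^+ 2) (last n s)).
Proof.
elim: s n => [|m s IH] n; first by rewrite !big_geq // expr0 !mul1r.
by rewrite /= IH !big_nat_recl //= [in RHS]exprD !invfM; ring.
Qed.

Lemma chain_termE i n s : (i <= size s)%N ->
  chain_term i n s = p ^+ (\sum_(0 <= j < size s) nth 0 s j ^ 2
                           + \sum_(i <= j < size s) nth 0 s j)%N
    * (1 + p ^+ nth 0%N (n :: s) i)
    / ((\prod_(0 <= j < size s) qf (nth 0 (n :: s) j - nth 0 s j)%N)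
       * poch (p ^+ 2) (p ^+ 2) (last n s)).
Proof.
elim: i n s => [|i IH] n s.
  by rewrite /= chain_tailE big_split /= => _; ring.
case: s => [//|m s] le_i; rewrite /= IH // big_add1 /= ![in RHS](@big_nat_recl _ _ _ _ 0) //=.
by rewrite -addnA [in RHS]exprD !invfM; ring.
Qed.

(** Each of the [a] steps is one application of [bker_chain] relative to p, multiplying the
    coefficient by p^(r^2 + r); the start is [bker1_bottom]. *)
Lemma chain_tail_sum a n :
  \sum_(s <- chains a n) chain_tail n s
  = \sum_(r < n.+1) (-1) ^+ r * p ^+ (r ^ 2 + a * (r ^ 2 + r))
      * (1 - p * p ^+ r ^+ 2) * bker 1 n r.
Proof.
elim: a n => [|a IH] n.
  rewrite big_seq1 /= -bker1_bottom; apply: eq_bigr => r _.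
  by rewrite mul0n addn0.
rewrite big_chainsS; under eq_bigr => m _.
  rewrite /= -mulr_sumr IH -{2}[nat_of_ord m]mul1n.
over.
rewrite (bker_chain_sum 1 (fun r => (-1) ^+ r * p ^+ (r ^ 2 + a * (r ^ 2 + r))
  * (1 - p * p ^+ r ^+ 2))).
apply: eq_bigr => r _; congr (_ * _).
rewrite mulrAC; congr (_ * _); rewrite -mulrA -exprD; congr (_ * p ^+ _); lia.
Qed.

(** For r >= 1 this is G r - p^(r-1) G (r - 1) with G r = (-1)^r p^(r^2 + a (r^2 + r)), as produced
    by the lattice step. At r = 0 there is no second term, hence 1 and not 2. *)
Definition theta_coef a r : F := if r is 0 then 1 else
  (-1) ^+ r * p ^+ (a.+1 * (r ^ 2 - r)) * (1 + p ^+ (a.*2.+1 * r)).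

Lemma chain_term_sum a i n :
  \sum_(s <- chains (i + a) n) chain_term i n s
  = \sum_(r < n.+1) (1 + p ^+ r) * (theta_coef a r * p ^+ (i * r ^ 2))
      * bker 0 n r.
Proof.
elim: i n => [|i IH] n.
  rewrite /= -mulr_sumr chain_tail_sum.
  rewrite (bker_lattice_sum (fun r => (-1) ^+ r * p ^+ (r ^ 2 + a * (r ^ 2 + r)))).
  apply: eq_bigr => -[[|t] /= _] _; first by rewrite !muln0 expr0 subr0 !mulr1.
  rewrite mul0n expr0 mulr1; congr (_ * _ * _).
  have tt : (t.+1 ^ 2 = t ^ 2 + t + t.+1)%N by lia.
  have -> : (t.+1 ^ 2 + a * (t.+1 ^ 2 + t.+1)
    = a.+1 * (t.+1 ^ 2 - t.+1) + a.*2.+1 * t.+1)%N by rewrite tt addnK; lia.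
  have -> : (a.+1 * (t.+1 ^ 2 - t.+1) = t + (t ^ 2 + a * (t ^ 2 + t)))%N
    by rewrite tt addnK; lia.
  by rewrite (exprS (-1)) (exprD _ _ (a.*2.+1 * _)) (exprD _ t); ring.
rewrite addSn big_chainsS; under eq_bigr => m _.
  rewrite /= -mulr_sumr IH -[(m ^ 2)%N]addn0 -(mul0n m).
over.
rewrite (bker_chain_sum 0
  (fun r => (1 + p ^+ r) * (theta_coef a r * p ^+ (i * r ^ 2)))).
apply: eq_bigr => r _; congr (_ * _).
by rewrite -!mulrA -exprD; do 2!congr (_ * _); congr (_ ^+ _); lia.
Qed.

(** The three-term recurrence of the Rogers-Szego polynomials, divided by (p; p)_N. Writing 1 -
    p^(N+2) as (1 - p^u) + (p^u - p^(N+2)), the first part shifts u and the second lowers N; the p^u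
    it leaves is 1 - (1 - p^u), which shifts u once more. *)
Lemma rogers_szego_rec N x (S := fun N =>
    \sum_(u < N.+1) x ^+ u / (qf u * qf (N - u))) :
  (1 - p ^+ N.+2) * S N.+2 = (1 + x) * S N.+1 - x * S N.
Proof.
pose t N u := x ^+ u * qfVB N u / qf u.
have SE M d : S M = \sum_(u < M.+1 + d) t M u.
  rewrite big_split_ord /= [X in _ + X]big1 ?addr0; last first.
    by move=> u _; rewrite /t qfVB_gt ?mulr0 ?mul0r // ltn_addr.
  apply: eq_bigr => u _; rewrite /t /qfVB -ltnS ltn_ord invfM.
  by rewrite mulrA mulrAC.
have shift M u : (1 - p ^+ u.+1) * t M.+1 u.+1 = x * t M u.
  rewrite /t qfVBSS pochS -exprS (exprS x).
  by field; rewrite qf_neq0 subr_eq0 eq_sym p_nonroot.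
have E u : (1 - p ^+ N.+2) * t N.+2 u
    = (1 - p ^+ u) * t N.+2 u + t N.+1 u - (1 - p ^+ u) * t N.+1 u.
  have -> : (1 - p ^+ N.+2) * t N.+2 u
    = (1 - p ^+ u) * t N.+2 u + x ^+ u * ((p ^+ u - p ^+ N.+2) * qfVB N.+2 u) / qf u.
    by rewrite /t; ring.
  by rewrite -qfVB_recl qfVBSS /t; ring.
rewrite (SE N.+2 0) addn0 mulr_sumr; under eq_bigr do rewrite E.
rewrite sumrB big_split /= -[N.+3]addn1 -(SE N.+1) addn1.
rewrite big_ord_recl expr0 subrr mul0r add0r.
rewrite [X in _ - X]big_ord_recl expr0 subrr mul0r add0r.
under eq_bigr do rewrite shift; under [X in _ - X]eq_bigr do rewrite shift.
rewrite -!mulr_sumr -[N.+2 in X in _ - X]addn1 -(SE N) -[N.+2]addn0 -(SE N.+1).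
ring.
Qed.

(** Same splitting of 1 - p^(N+1): both parts return the sum for [N] at the argument x p, once with
    factor 1 and once with factor x, which gives the new factor 1 + x. *)
Lemma q_binomial N x :
  \sum_(u < N.+1) p ^+ 'C(u, 2) * x ^+ u / (qf u * qf (N - u))
  = poch (- x) p N / qf N.
Proof.
elim: N x => [|N IH] x.
  by rewrite big_ord1 !poch0 !expr0 !mulr1.
pose t N x u := p ^+ 'C(u, 2) * x ^+ u * qfVB N u / qf u.
have SE M y : \sum_(u < M.+1) p ^+ 'C(u, 2) * y ^+ u / (qf u * qf (M - u))
    = \sum_(u < M.+1) t M y u.
  apply: eq_bigr => u _; rewrite /t /qfVB -ltnS ltn_ord invfM.
  by rewrite mulrA mulrAC.
have t0 : t N (x * p) N.+1 = 0 by rewrite /t qfVB_gt // mulr0 mul0r.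
have E u : (1 - p ^+ N.+1) * t N.+1 x u = (1 - p ^+ u) * t N.+1 x u + t N (x * p) u.
  have -> : t N (x * p) u
      = p ^+ 'C(u, 2) * x ^+ u * (p ^+ u * qfVB N.+1 u.+1) / qf u.
    by rewrite /t qfVBSS exprMn; ring.
  by rewrite qfVB_recl /t; ring.
have shift u : (1 - p ^+ u.+1) * t N.+1 x u.+1 = x * t N (x * p) u.
  rewrite /t qfVBSS pochS -exprS binS bin1 exprD exprMn [x ^+ _]exprS.
  by field; rewrite qf_neq0 subr_eq0 eq_sym p_nonroot.
apply: (mulfI (one_sub_pow N)); rewrite -exprS SE mulr_sumr.
under eq_bigr do rewrite E.
rewrite big_split /= [X in _ + X]big_ord_recr /= t0 addr0.
rewrite big_ord_recl expr0 subrr mul0r add0r; under [X in X + _ = _]eq_bigr do rewrite shift.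
rewrite -mulr_sumr -SE IH pochSl pochS -exprS opprK mulNr.
by field; rewrite qf_neq0 subr_eq0 eq_sym p_nonroot.
Qed.

End FiniteIdentities.

(** * Base p = q^2: a Rogers-Szego evaluation and the partial q-Gauss sum *)

Section SquareBase.
Variables (F : fieldType) (q : F).
Hypothesis q_neq0 : q != 0.
Hypothesis q_nonroot : forall n, q ^+ n.+1 != 1.

Local Notation p := (q ^+ 2).
Local Notation qf := (poch p p).

Lemma sqr_neq0 : p != 0.
Proof. by rewrite expf_neq0. Qed.

Lemma sqr_nonroot n : p ^+ n.+1 != 1.
Proof. by rewrite -exprM mulnS addSn. Qed.

Let qf_neq0 := qf_neq0 sqr_nonroot.

(** The Rogers-Szego polynomial factors at x = q, the square root of its base. The recurrence has
    order two, so the induction carries two consecutive values. *)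
Lemma rogers_szego_sqrt N :
  \sum_(u < N.+1) q ^+ u / (qf u * qf (N - u)) = (poch q q N)^-1.
Proof.
have nz n : 1 - q * q ^+ n != 0 by rewrite -exprS subr_eq0 eq_sym.
suff: \sum_(u < N.+1) q ^+ u / (qf u * qf (N - u)) = (poch q q N)^-1 /\
      \sum_(u < N.+2) q ^+ u / (qf u * qf (N.+1 - u)) = (poch q q N.+1)^-1.
  by case.
elim: N => [|N [IH0 IH1]].
  rewrite !big_ord_recr !big_ord0 /= subnn subn0 !(poch0, pochS) !expr0.
  have := nz 0; have := nz 1; rewrite expr0 expr1 mulr1 => z1 z0.
  split; first by rewrite add0r !mulr1 invr1 mulr1.
  by field; rewrite z0 z1.
split=> //; have z : 1 - p ^+ N.+2 != 0 by rewrite subr_eq0 eq_sym sqr_nonroot.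
apply: (mulfI z); rewrite rogers_szego_rec //; last exact: sqr_nonroot.
rewrite IH0 IH1 !(pochS q q) -exprM mulnC exprM !(exprS q N) !(exprS q N.+1).
have : poch q q N != 0 by apply/prodf_neq0 => j _; apply: nz.
have := nz N; have := nz N.+1; rewrite !exprS.
move: (poch q q N) (q ^+ N) => w x z1 z0 zw.
by field; rewrite z0 z1 zw.
Qed.

(* This is [(-q; q)_(2n - 1)], including the value [1/2] at [n = 0]. *)
Definition outer_weight n : F := poch (-1) q n.*2 / 2.

Lemma outer_weightS n :
  outer_weight n.+1 = outer_weight n * (1 + q ^+ n.*2) * (1 + q ^+ n.*2.+1).
Proof. by rewrite /outer_weight doubleS !pochS !mulN1r !opprK; ring. Qed.

(* Gosper-style certificate behind the [q]-Gauss sum with parameters [-1, -q]: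
   after normalisation, the partial sums for [r] and [r + 1] differ by a single
   boundary term. *)
Lemma outer_step r M :
  (1 + p ^+ r) / q ^+ r * (\sum_(n < M.+1) q ^+ n * outer_weight n * bker p 0 n r)
  - (1 + p ^+ r.+1) / q ^+ r.+1
    * (\sum_(n < M.+1) q ^+ n * outer_weight n * bker p 0 n r.+1)
  = (q^-1 - p ^+ r) * q ^+ M.+1 / q ^+ r * outer_weight M.+1
    * (qfVB p M r / qf (M + r).+1).
Proof.
pose G n := (q^-1 - p ^+ r) * q ^+ n / q ^+ r * outer_weight n
  * (qfVB p n r.+1 / qf (n + r)).
have zr : q ^+ r != 0 by rewrite expf_neq0.
have E n : (1 + p ^+ r) / q ^+ r * (q ^+ n * outer_weight n * bker p 0 n r)
  - (1 + p ^+ r.+1) / q ^+ r.+1 * (q ^+ n * outer_weight n * bker p 0 n r.+1)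
  = G n.+1 - G n.
  rewrite /G /bker !addn0 addSn !addnS qfVBSS outer_weightS.
  rewrite (qfVS sqr_nonroot (n + r)).
  have -> : qfVB p n r.+1 = (p ^+ r - p ^+ n) * qfVB p n r / p ^+ r.
    rewrite -qfVB_recl; last exact: sqr_nonroot.
    by rewrite mulrAC divff ?mul1r // expf_neq0 // sqr_neq0.
  rewrite -muln2 mulnC (exprS q (2 * n)) (exprS q r) (exprS q n) (exprD p n).
  rewrite (exprS p r) (exprM q) !(exprAC q 2).
  have := qf_neq0 (n + r).+1.
  move: (qfVB _ _ _) (poch _ _ _) (outer_weight n) (q ^+ n) (q ^+ r) zr => a b w x y zy zb.
  by field; rewrite q_neq0 zy zb.
rewrite !mulr_sumr -sumrB; under eq_bigr do rewrite E.
rewrite -(big_mkord predT (fun n => G n.+1 - G n)) telescope_sumr //.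
by rewrite /G [qfVB _ 0 _]qfVB_gt // mul0r mulr0 subr0 qfVBSS addSn.
Qed.

Lemma outer_sum r M : (r <= M)%N ->
  (1 + p ^+ r) * (\sum_(n < M.+1) q ^+ n * outer_weight n * bker p 0 n r)
  = q ^+ r * (outer_weight M.+1 *
      \sum_(u < (M - r).+1) (q ^+ u - q ^+ (M.*2.+1 - u)) / (qf u * qf (M.*2.+1 - u))).
Proof.
move=> le_rM; have zr m : q ^+ m != 0 by rewrite expf_neq0.
(* Descending induction on r = M + 1 - d. It starts at r = M + 1, where every kernel is zero, and
   the boundary term of [outer_step] at r = M - d is the summand u = d. *)
suff tele d : (d <= M.+1)%N ->
  (1 + p ^+ (M.+1 - d)) / q ^+ (M.+1 - d)
    * (\sum_(n < M.+1) q ^+ n * outer_weight n * bker p 0 n (M.+1 - d))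
  = outer_weight M.+1 *
      \sum_(u < d) (q ^+ u - q ^+ (M.*2.+1 - u)) / (qf u * qf (M.*2.+1 - u)).
  have := tele (M - r).+1; rewrite subSS subKn // ltnS leq_subr => /(_ isT) <-.
  by field.
elim: d => [_|d IH lt_dM].
  rewrite subn0 big_ord0 mulr0 big1 ?mulr0 // => n _.
  by rewrite bker_gt ?mulr0.
have := outer_step (M.+1 - d.+1) M; rewrite -[(_ - d.+1).+1]subSn // subSS.
rewrite IH 1?ltnW // => /eqP; rewrite subr_eq => /eqP ->.
rewrite big_ord_recr /= mulrDr addrC; congr (_ + _).
have le_dM : (d <= M)%N by [].
rewrite /qfVB leq_subr subKn //; have := qf_neq0 d.
have -> : (M + (M - d)).+1 = (M.*2.+1 - d)%N by lia.
set P := qf (M.*2.+1 - d); have : P != 0 by exact: qf_neq0.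
have -> : q ^+ (M.*2.+1 - d) = q * p ^+ (M - d) * q ^+ d.
  by rewrite -exprM -exprS -exprD; congr (_ ^+ _); lia.
have -> : q ^+ M.+1 = q * q ^+ (M - d) * q ^+ d.
  by rewrite -exprS -exprD; congr (_ ^+ _); lia.
move: (zr (M - d)%N) => z0 z1 z2; field.
by rewrite q_neq0 z0 z1 z2.
Qed.

End SquareBase.

(** * A finite form of the Jacobi triple product *)

Section FiniteJacobi.
Variables (F : fieldType) (t y : F).
Hypothesis t_neq0 : t != 0.
Hypothesis y_neq0 : y != 0.
Hypothesis t_nonroot : forall n, t ^+ n.+1 != 1.

Local Notation p := (t ^+ 2).

(** The bilateral theta series with terms (-1)^r t^(r^2) y^r, folded by adding the terms r and -r;
    at r = 0 they are the same term, counted once. *)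
Definition jacobi_coef r : F := if r is 0 then 1 else
  (-1) ^+ r * t ^+ (r ^ 2) * (y ^+ r + y ^- r).

(** The q-binomial theorem of order 2n at x = -y t / p^n, recentred at u = n: half of the product is
    turned over by [poch_rev] into (t/y; p)_n, and the terms u = n + r and u = n - r form the two
    halves of [jacobi_coef]. *)
Lemma finite_jacobi n :
  poch (y * t) p n * poch (t / y) p n
  = poch p p n.*2 * \sum_(r < n.+1) jacobi_coef r * bker p 0 n r.
Proof.
have p_nonroot := sqr_nonroot t_nonroot.
have p_neq0 : p != 0 by rewrite expf_neq0.
have z m : t ^+ m != 0 by rewrite expf_neq0.
have zy m : y ^+ m != 0 by rewrite expf_neq0.
have nz (s : F) m : s != 0 -> s ^+ m != 0 by move=> s0; rewrite expf_neq0.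
have yt_neq0 : y * t != 0 by rewrite mulf_neq0.
have tri u : (2 * 'C(u, 2) + u = u ^ 2)%N.
  by elim: u => [//|u IH]; rewrite binS bin1; lia.
pose H u := p ^+ 'C(u, 2) * (- (y * t / p ^+ n)) ^+ u
  / (poch p p u * poch p p (n.*2 - u)).
(* The inverse of the prefactor that [poch_rev] produces. *)
pose c := p ^+ 'C(n.+1, 2) / (- (y * t)) ^+ n.
have E : poch (y * t) p n * poch (t / y) p n
    = poch p p n.*2 * \sum_(u < n.*2.+1) c * H u.
  rewrite -mulr_sumr /H q_binomial // opprK -addnn (pochD (y * t / p ^+ n)).
  rewrite divfK ?nz // poch_rev //.
  have -> : p / (y * t) = t / y by field; rewrite t_neq0 y_neq0.
  rewrite /c addnn; move: (poch (y * t) p n) (poch (t / y) p n) => a b.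
  by field; rewrite qf_neq0 // !nz // oppr_eq0.
have Hplus r : (r <= n)%N -> c * H (n + r)%N
    = (-1) ^+ r * t ^+ (r ^ 2) * y ^+ r * bker p 0 n r.
  move=> le_rn; rewrite /H /bker /qfVB le_rn addn0 -addnn subnDl.
  have -> : c * (p ^+ 'C(n + r, 2) * (- (y * t / p ^+ n)) ^+ (n + r)
    / (poch p p (n + r) * poch p p (n - r)))
    = c * p ^+ 'C(n + r, 2) * (- (y * t / p ^+ n)) ^+ (n + r)
      * ((poch p p (n - r))^-1 / poch p p (n + r)) by rewrite invfM; ring.
  congr (_ * _); rewrite /c -[- (y * t / _)]mulNr expr_div_n exprD.
  have e : p ^+ 'C(n.+1, 2) * p ^+ 'C(n + r, 2) * t ^+ r
      = t ^+ (r ^ 2) * p ^+ n ^+ (n + r).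
    rewrite -!exprM -!exprD; congr (_ ^+ _).
    by have := tri n.+1; have := tri (n + r)%N; lia.
  have -> : (- (y * t)) ^+ r = (-1) ^+ r * y ^+ r * t ^+ r.
    by rewrite -!exprMn mulN1r mulNr.
  transitivity (p ^+ 'C(n.+1, 2) * p ^+ 'C(n + r, 2) * t ^+ r
    * ((-1) ^+ r * y ^+ r / p ^+ n ^+ (n + r))).
    by field; rewrite !nz // oppr_eq0.
  by rewrite e; field; rewrite !nz.
have Hminus r : (r <= n)%N -> c * H (n - r)%N
    = (-1) ^+ r * t ^+ (r ^ 2) * y ^- r * bker p 0 n r.
  move=> le_rn; rewrite /H /bker /qfVB le_rn addn0.
  have -> : (n.*2 - (n - r) = n + r)%N by lia.
  have -> : c * (p ^+ 'C(n - r, 2) * (- (y * t / p ^+ n)) ^+ (n - r)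
    / (poch p p (n - r) * poch p p (n + r)))
    = c * p ^+ 'C(n - r, 2) * (- (y * t / p ^+ n)) ^+ (n - r)
      * ((poch p p (n - r))^-1 / poch p p (n + r)) by rewrite invfM; ring.
  congr (_ * _).
  rewrite /c -[- (y * t / _)]mulNr expr_div_n.
  have e : p ^+ 'C(n.+1, 2) * p ^+ 'C(n - r, 2)
      = t ^+ (r ^ 2) * p ^+ n ^+ (n - r) * t ^+ r.
    rewrite -!exprM -!exprD; congr (_ ^+ _).
    by have := tri n.+1; have := tri (n - r)%N; have := subnK le_rn;
      move: (n - r)%N => m <-; lia.
  have -> : (- (y * t)) ^+ n = (- (y * t)) ^+ (n - r) * ((-1) ^+ r * y ^+ r * t ^+ r).
    by rewrite -!exprMn mulN1r -mulNr -exprD subnK.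
  have sgn : (-1) ^+ r * (-1) ^+ r = 1 :> F by rewrite -exprMn mulN1r opprK expr1n.
  transitivity (p ^+ 'C(n.+1, 2) * p ^+ 'C(n - r, 2)
    * ((-1) ^+ r / ((-1) ^+ r * (-1) ^+ r) / y ^+ r / t ^+ r / p ^+ n ^+ (n - r))).
    by field; rewrite !nz // oppr_eq0 ?oner_eq0.
  by rewrite e sgn; field; rewrite !nz ?oner_eq0 ?oner_neq0.
rewrite E; congr (_ * _); rewrite -addnn -addnS big_split_ord /=.
(* The indices below n are reversed to n - r with r >= 1, to be paired with n + r; the central index
   n is left alone. *)
rewrite (reindex_inj rev_ord_inj) /= addrC.
rewrite !big_ord_recl /= addn0 -{1}[n]addn0 Hplus // -addrA; congr (_ + _).
  by rewrite !expr0 !mul1r.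
rewrite -big_split /=; apply: eq_bigr => r _ /=.
by rewrite /bump add1n Hplus ?Hminus // -mulrDl -mulrDr.
Qed.

End FiniteJacobi.

(** * Limits *)

Section ComplexLimits.
Variable R : realType.
Local Notation C := (complex R : numFieldType).
Implicit Types (u v : nat -> C) (x y : C).

Lemma normc_real x : `|x| = (normc x)%:C%C.
Proof. by []. Qed.

Lemma ler_normcD x y : normc (x + y) <= normc x + normc y.
Proof. exact: le_normcD. Qed.

Lemma normcNE x : normc (- x) = normc x.
Proof. exact: normcN. Qed.

Lemma normc_ge0 x : 0 <= normc x.
Proof. by case: x => a b; exact: sqrtr_ge0. Qed.

Lemma normcX x n : normc (x ^+ n) = normc x ^+ n.
Proof. by elim: n => [|n IH]; rewrite ?expr0 ?normc1 // !exprS normcM IH. Qed.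

Lemma normc_sum (I : Type) (s : seq I) (P : pred I) (f : I -> C) :
  normc (\sum_(i <- s | P i) f i) <= \sum_(i <- s | P i) normc (f i).
Proof.
elim/big_rec2: _ => [|i a b _ le_ba]; first by rewrite normc0.
by rewrite (le_trans (ler_normcD _ _)) // lerD2l.
Qed.

Lemma normc_prod (I : Type) (s : seq I) (P : pred I) (f : I -> C) :
  normc (\prod_(i <- s | P i) f i) = \prod_(i <- s | P i) normc (f i).
Proof. by elim/big_rec2: _ => [|i a b _ <-]; rewrite ?normc1 ?normcM. Qed.

Lemma normc_distC x y : normc (x - y) = normc (y - x).
Proof. by rewrite -normcNE opprB. Qed.

Lemma normc_sub x y : normc x - normc y <= normc (x - y).
Proof. by rewrite lerBlDr (le_trans _ (ler_normcD _ _)) // subrK. Qed.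

(** The norm of [complex R] has values in [complex R]. Passing to [normc] makes squeezing and
    comparison in the real field available. *)
Lemma cvgcP u x : u @ \oo --> x <-> (fun n => normc (u n - x)) @ \oo --> (0 : R).
Proof.
split=> [ux|ux].
  apply/cvgrPdist_lt => e e_gt0; move/cvgrPdist_lt: ux.
  move/(_ e%:C%C); rewrite ltcR => /(_ e_gt0); apply: filterS => n.
  rewrite normc_real ltcR sub0r normrN ger0_norm ?normc_ge0 //.
  by rewrite normc_distC.
apply/cvgrPdist_lt => e e_gt0.
have /complex_realP[r er] : e \is Num.real by rewrite gtr0_real.
move: e_gt0; rewrite er ltcR => r_gt0.
move/cvgrPdist_lt: ux => /(_ _ r_gt0); apply: filterS => n.
rewrite sub0r normrN ger0_norm ?normc_ge0 // => lt_r.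
by rewrite normc_real ltcR normc_distC.
Qed.

Lemma cvg_normc u x : u @ \oo --> x -> (fun n => normc (u n)) @ \oo --> normc x.
Proof.
move/cvgcP => ux; apply/cvgrPdist_lt => e e_gt0.
move/cvgrPdist_lt: ux => /(_ _ e_gt0); apply: filterS => n; apply: le_lt_trans.
rewrite sub0r normrN [leRHS]ger0_norm ?normc_ge0 // ler_norml.
have := normc_sub x (u n); have := normc_sub (u n) x; rewrite (normc_distC x).
lra.
Qed.

Lemma geometric_sum_le (t : R) n : 0 <= t < 1 -> \sum_(j < n) t ^+ j <= (1 - t)^-1.
Proof.
move=> /andP[t0 t1]; have d_gt0 : 0 < 1 - t by rewrite subr_gt0.
rewrite -(ler_pM2l d_gt0) divff ?gt_eqF //.
have := subrX1 t n; rewrite -[t - 1]opprB -[_ - 1]opprB mulNr => /oppr_inj <-.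
by rewrite gerBl exprn_ge0.
Qed.

Lemma cvg_geometric0 (c t : R) : 0 <= t < 1 -> (fun n => c * t ^+ n) @ \oo --> (0 : R).
Proof.
move=> /andP[t0 t1]; apply: (@cvg_geometric _ c t); by rewrite ger0_norm.
Qed.

Lemma is_cvg_real_geometric (v : nat -> R) (c t : R) : 0 <= t < 1 ->
  (forall n, `|v n.+1 - v n| <= c * t ^+ n) -> cvgn v.
Proof.
move=> t01 vb; have -> : v = cst (v 0%N) \+ series (telescope v).
  by apply/funext => n; rewrite /= -eq_sum_telescope.
apply: is_cvgD; first exact: is_cvg_cst.
apply: normed_cvg; apply: (@series_le_cvg _ _ (geometric c t)) => [n|n|n|].
- exact: normr_ge0.
- by rewrite (le_trans _ (vb n)).
- exact: vb.
- by apply: is_cvg_geometric_series; case/andP: t01 => t0 t1; rewrite ger0_norm.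
Qed.

(** Real and imaginary parts are bounded by [normc], so each is a real sequence with geometrically
    small increments. *)
Lemma is_cvgc_geometric u (c t : R) : 0 <= t < 1 ->
  (forall n, normc (u n.+1 - u n) <= c * t ^+ n) -> cvgn u.
Proof.
move=> t01 ub.
have reb (z : C) : `|complex.Re z| <= normc z.
  by have := normc_ge_Re z; rewrite normc_real lecR.
have imb (z : C) : `|complex.Im z| <= normc z.
  case: z => a b /=; rewrite -sqrtr_sqr ler_sqrt ?lerDr ?sqr_ge0 //.
  by rewrite addr_ge0 ?sqr_ge0.
have split_le (z : C) : normc z <= `|complex.Re z| + `|complex.Im z|.
  case: z => a b /=; rewrite -[leRHS]ger0_norm ?addr_ge0 // -sqrtr_sqr ler_sqrt ?sqr_ge0 //.
  by rewrite sqrrD !real_normK ?num_real // -addrA lerD2l lerDr mulrn_wge0 ?mulr_ge0.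
have /cvg_ex[a ca] : cvgn (fun n => complex.Re (u n)).
  apply: (is_cvg_real_geometric (c := c) t01) => n.
  have -> : complex.Re (u n.+1) - complex.Re (u n) = complex.Re (u n.+1 - u n).
    by case: (u n) (u n.+1) => [? ?] [].
  exact: le_trans (reb _) (ub n).
have /cvg_ex[b cb] : cvgn (fun n => complex.Im (u n)).
  apply: (is_cvg_real_geometric (c := c) t01) => n.
  have -> : complex.Im (u n.+1) - complex.Im (u n) = complex.Im (u n.+1 - u n).
    by case: (u n) (u n.+1) => [? ?] [].
  exact: le_trans (imb _) (ub n).
apply/cvg_ex; exists (a +i* b)%C; apply/cvgcP.
have lim0 : (fun n => `|complex.Re (u n) - a| + `|complex.Im (u n) - b|) @ \oo --> (0 : R).
  rewrite -[0](addr0 (0 : R)); apply: cvgD.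
    by rewrite -(normr0 R) -(subrr a); apply: cvg_norm; apply: cvgB => //; exact: cvg_cst.
  by rewrite -(normr0 R) -(subrr b); apply: cvg_norm; apply: cvgB => //; exact: cvg_cst.
apply: (squeeze_cvgr _ (@cvg_cst _ _ _ _ _) lim0); near=> n.
rewrite normc_ge0 /=; apply: le_trans (split_le _) _.
by case: (u n).
Unshelve. all: by end_near.
Qed.

End ComplexLimits.

(** * Dominated convergence of series, and infinite q-products *)

Section Tannery.
Variable R : realType.
Local Notation C := (complex R : numFieldType).
Implicit Types (u v : nat -> C) (x y a q : C).

Lemma cvgc_bounded u x : u @ \oo --> x -> exists B : R, forall n, normc (u n) <= B.
Proof.
move=> /cvg_normc ux.
have /cvg_seq_bounded : cvgn (fun n => normc (u n) : R^o) by apply/cvg_ex; exists (normc x).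
move=> [B [_ bB]]; exists (B + 1) => n.
by have /(_ n I) := bB (B + 1) (ltr_pwDr ltr01 (lexx _)); rewrite /= ger0_norm ?normc_ge0.
Qed.

Lemma cvgc_squeeze u (b : nat -> R) :
  (forall n, normc (u n) <= b n) -> b @ \oo --> (0 : R) -> u @ \oo --> (0 : C).
Proof.
move=> ub b0; apply/cvgcP; apply: (squeeze_cvgr _ (@cvg_cst _ _ _ _ _) b0).
by near=> n; rewrite subr0 normc_ge0 ub.
Unshelve. all: by end_near.
Qed.

Lemma cvg_sum_ord (n : nat) (f : nat -> nat -> C) (g : nat -> C) :
  (forall r, f^~ r @ \oo --> g r) ->
  (fun M => \sum_(r < n) f M r) @ \oo --> \sum_(r < n) g r.
Proof.
move=> fg; elim: n => [|n IH].
  rewrite big_ord0; under eq_fun do rewrite big_ord0; exact: cvg_cst.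
rewrite big_ord_recr; under eq_fun do rewrite big_ord_recr.
by apply: cvgD; [exact: IH|exact: fg].
Qed.

(** Dominated convergence with a geometric majorant, where the range of summation grows together
    with the parameter. The common limit stays anonymous: each use identifies it through uniqueness
    of limits from whichever side has a closed form. *)
Lemma tannery (f : nat -> nat -> C) (g : nat -> C) (c t : R) : 0 <= t < 1 ->
  (forall M r, normc (f M r) <= c * t ^+ r) -> (forall r, f^~ r @ \oo --> g r) ->
  exists2 S : C, (fun M => \sum_(r < M.+1) g r) @ \oo --> S
              & (fun M => \sum_(r < M.+1) f M r) @ \oo --> S.
Proof.
move=> t01 fb fg; have [t0 t1] := andP t01.
have c0 : 0 <= c by have := fb 0%N 0%N; rewrite expr0 mulr1; exact: le_trans (normc_ge0 _).
have gb r : normc (g r) <= c * t ^+ r.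
  rewrite leNgt; apply/negP => lt_g; have d0 : 0 < normc (g r) - c * t ^+ r by rewrite subr_gt0.
  have /cvgcP/cvgrPdist_lt/(_ _ d0)[N _ /(_ N (leqnn N))] := fg r.
  rewrite /= sub0r normrN ger0_norm ?normc_ge0 // normc_distC.
  have := normc_sub (g r) (f N r); have := fb N r; lra.
have /cvg_ex[S gS] : cvgn (fun M => \sum_(r < M.+1) g r).
  apply: (is_cvgc_geometric (c := c * t) t01) => M.
  by rewrite big_ord_recr /= addrAC subrr add0r -mulrA -exprS.
exists S => //; have d_gt0 : 0 < 1 - t by rewrite subr_gt0.
pose h M := \sum_(r < M.+1) (f M r - g r).
suff h0 : h @ \oo --> (0 : C).
  apply: (cvg_sub0 _ gS); rewrite (_ : _ - _ = h) //.
  by apply/funext => M; rewrite /h sumrB.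
apply/cvgcP/cvgrPdist_lt => e e0.
(* Terms from K on contribute at most 2 c t^K / (1 - t), since both [f M] and [g] obey the majorant;
   K makes this less than e/2, and the K terms before are handled by termwise convergence. *)
have tail0 := @cvg_geometric0 R (2 * c / (1 - t)) t t01.
have e20 : 0 < e / 2 by rewrite divr_gt0.
move/cvgrPdist_lt: tail0 => /(_ _ e20)[K _ /(_ K (leqnn K))].
have pos : 0 <= 2 * c / (1 - t) * t ^+ K.
  by rewrite mulr_ge0 ?exprn_ge0 // divr_ge0 ?mulr_ge0 // ltW.
rewrite /= sub0r normrN ger0_norm // => tailK.
have headK : (fun M => \sum_(r < K) (f M r - g r)) @ \oo --> (0 : C).
  rewrite [X in _ --> X](_ : 0 = \sum_(r < K) (g r - g r)); last first.
    by rewrite big1 // => r _; rewrite subrr.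
  apply: (@cvg_sum_ord K (fun M r => f M r - g r) (fun r => g r - g r)) => r.
  by apply: cvgB; [exact: fg|exact: cvg_cst].
move/cvgcP/cvgrPdist_lt: headK => /(_ _ e20) headK; near=> M.
have le_KM : (K <= M.+1)%N by near: M; exists K => // M; exact: leqW.
have : `|0 - normc (\sum_(r < K) (f M r - g r) - 0)| < e / 2 by near: M.
rewrite !subr0 !sub0r !normrN !ger0_norm ?normc_ge0 // => hd.
rewrite /h -(big_mkord predT (fun r => f M r - g r)) (big_cat_nat _ le_KM) //= big_mkord.
apply: le_lt_trans (ler_normcD _ _) _; rewrite (splitr e) ltr_leD //.
apply: le_trans (ltW tailK); apply: le_trans (normc_sum _ _ _) _.
apply: (@le_trans _ _ (\sum_(K <= r < M.+1) 2 * c * t ^+ r)).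
  apply: ler_sum => r _; apply: le_trans (ler_normcD _ _) _; rewrite normcNE.
  have := fb M r; have := gb r; lra.
rewrite -mulr_sumr -{1}[K]add0n big_addn big_mkord.
under eq_bigr do rewrite exprD; rewrite -mulr_suml.
have := geometric_sum_le (M.+1 - K) t01; set s := \sum_(i < _) _ => les.
rewrite [leRHS]mulrAC -!mulrA; apply: ler_wpM2l => //; apply: ler_wpM2l => //.
by rewrite mulrC ler_wpM2l ?exprn_ge0.
Unshelve. all: by end_near.
Qed.

Lemma poch_bounded a q : normc q < 1 ->
  forall n, normc (poch a q n) <= expR (normc a / (1 - normc q)).
Proof.
move=> q1 n; have q0 := normc_ge0 q; have a0 := normc_ge0 a.
apply: (@le_trans _ _ (expR (\sum_(j < n) normc a * normc q ^+ j))).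
  rewrite expR_sum normc_prod; apply: ler_prod => j _; rewrite normc_ge0 /=.
  apply: le_trans (expR_ge1Dx _); apply: le_trans (ler_normcD _ _) _.
  by rewrite normcNE normc1 normcM normcX.
rewrite ler_expR -mulr_sumr; apply: ler_wpM2l => //.
by apply: geometric_sum_le; rewrite q0.
Qed.

Lemma poch_cvg a q : normc q < 1 -> poch a q @ \oo --> qpoch_inf a q.
Proof.
move=> q1; suff : cvgn (poch a q) by [].
apply: (@is_cvgc_geometric R _ (expR (normc a / (1 - normc q)) * normc a) (normc q)).
  by rewrite normc_ge0.
move=> n; rewrite pochS (_ : _ - _ = - (poch a q n * (a * q ^+ n))); last by ring.
rewrite normcNE !normcM normcX mulrA ler_wpM2r ?exprn_ge0 ?normc_ge0 //.
by rewrite ler_wpM2r ?normc_ge0 // poch_bounded.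
Qed.

Arguments poch_cvg a {q} _.

Lemma cvgc_unique u x y : u @ \oo --> x -> u @ \oo --> y -> x = y.
Proof. by move=> ux uy; apply: (cvg_unique _ ux uy); exact: norm_hausdorff. Qed.

Lemma qpoch_inf_shift a q m : normc q < 1 ->
  qpoch_inf a q = poch a q m * qpoch_inf (a * q ^+ m) q.
Proof.
move=> q1; have := poch_cvg a q1; rewrite -(cvg_shiftn m) => lim1.
apply: (cvgc_unique lim1); under eq_fun do rewrite /= addnC pochD.
by apply: cvgM; [exact: cvg_cst|exact: poch_cvg].
Qed.

Lemma weierstrass_prod_ge (n : nat) (x : nat -> R) : (forall j, 0 <= x j <= 1) ->
  1 - \sum_(j < n) x j <= \prod_(j < n) (1 - x j).
Proof.
move=> x01; elim: n => [|n IH]; first by rewrite !big_ord0 subr0.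
rewrite !big_ord_recr /=; have /andP[x0 x1] := x01 n.
have s0 : 0 <= \sum_(j < n) x j by apply: sumr_ge0 => j _; have /andP[] := x01 j.
have := ler_wpM2r (_ : 0 <= 1 - x n) IH; rewrite subr_ge0 => /(_ x1).
have := mulr_ge0 s0 x0; nra.
Qed.

(** Finitely many nonzero factors are split off until b = a q^m satisfies |b| / (1 - |q|) < 1/2.
    Weierstrass's product inequality then keeps all partial products of the rest at norm at least
    1/2. *)
Lemma qpoch_inf_neq0 a q : normc q < 1 -> (forall j, a * q ^+ j != 1) ->
  qpoch_inf a q != 0.
Proof.
move=> q1 nz; have q01 : 0 <= normc q < 1 by rewrite normc_ge0.
have d_gt0 : 0 < 1 - normc q by rewrite subr_gt0.
have half0 : (0 : R) < 2^-1 by rewrite invr_gt0.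
have := cvg_geometric0 (normc a / (1 - normc q)) q01.
move=> /cvgrPdist_lt/(_ _ half0)[m _ /(_ m (leqnn m))].
have t0 : 0 <= normc a / (1 - normc q) * normc q ^+ m.
  by rewrite mulr_ge0 ?exprn_ge0 ?normc_ge0 // divr_ge0 ?normc_ge0 // ltW.
rewrite /= sub0r normrN ger0_norm // mulrAC -normcX -normcM => tail.
set b := a * q ^+ m in tail.
rewrite (qpoch_inf_shift a m q1) mulf_neq0 //.
  exact: poch_neq0.
have b0 := normc_ge0 b.
have low n : 2^-1 <= normc (poch b q n).
  have le1 j : normc q ^+ j <= 1 by rewrite exprn_ile1 ?normc_ge0 // ltW.
  have b_half : normc b <= 2^-1.
    apply: le_trans (ltW tail); rewrite ler_peMr // invf_ge1 // gerBl normc_ge0 //.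
  apply: (@le_trans _ _ (\prod_(j < n) (1 - normc b * normc q ^+ j))).
    apply: le_trans (@weierstrass_prod_ge n (fun j => normc b * normc q ^+ j) _);
      last first.
      move=> j; rewrite mulr_ge0 ?exprn_ge0 ?normc_ge0 //=.
      by have := ler_wpM2l b0 (le1 j); rewrite mulr1; lra.
    rewrite -mulr_sumr; have := ler_wpM2l b0 (geometric_sum_le n q01).
    by set s := \sum_(j < n) _; move: tail; lra.
  rewrite normc_prod; apply: ler_prod => j _; apply/andP; split.
    by have := ler_wpM2l b0 (le1 j); rewrite mulr1; lra.
  by have := normc_sub 1 (b * q ^+ j); rewrite normc1 normcM normcX.
apply/eqP => lim0; have := poch_cvg b q1; rewrite /b lim0.
move=> /cvgcP/cvgrPdist_lt/(_ _ half0)[N _ /(_ N (leqnn N))].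
rewrite /= sub0r normrN subr0 ger0_norm ?normc_ge0 //.
by rewrite ltNge low.
Qed.

Lemma qpoch_nat a q n : normc q < 1 -> (forall j, a * q ^+ (n + j) != 1) ->
  qpoch a q n%:Z = poch a q n.
Proof.
move=> q1 nz; rewrite /qpoch -exprnP (qpoch_inf_shift a n q1) mulfK //.
by apply: qpoch_inf_neq0 => // j; rewrite -mulrA -exprD.
Qed.

Lemma poch_inv_cvg a q : normc q < 1 -> (forall j, a * q ^+ j != 1) ->
  (fun n => (poch a q n)^-1) @ \oo --> (qpoch_inf a q)^-1.
Proof. by move=> q1 nz; apply: cvgV; [exact: qpoch_inf_neq0|exact: poch_cvg]. Qed.

End Tannery.

(** * The limit of the sums cut at N_1 <= M *)

Section MainLimit.
Variables (R : realType) (q : (complex R : numFieldType)).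
Hypothesis q_neq0 : q != 0.
Hypothesis q_lt1 : normc q < 1.
Local Notation C := (complex R : numFieldType).
Local Notation p := (q ^+ 2).
Local Notation qf := (poch p p).

Lemma normc_pow_lt1 m : (0 < m)%N -> normc (q ^+ m) < 1.
Proof. by move=> m0; rewrite normcX exprn_ilt1 ?normc_ge0 // -lt0n. Qed.

Lemma normc_pow_le1 m : normc (q ^+ m) <= 1.
Proof. by rewrite normcX exprn_ile1 ?normc_ge0 // ltW. Qed.

Lemma normc_neq1 (x : C) : normc x < 1 -> x != 1.
Proof. by apply: contraTneq => ->; rewrite normc1 ltxx. Qed.

Lemma q_nonroot n : q ^+ n.+1 != 1.
Proof. by apply: normc_neq1; apply: normc_pow_lt1. Qed.

Lemma cvg_reindex (phi : nat -> nat) k (u : nat -> C) (x : C) :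
  (forall M, (M <= phi M + k)%N) -> u @ \oo --> x -> (u \o phi) @ \oo --> x.
Proof.
move=> le_phi ux; apply: cvg_comp ux; apply/cvgnyPge => B; near=> M.
have : (B + k <= M)%N by near: M; exact: nbhs_infty_ge.
by move=> BM; have := leq_trans BM (le_phi M); rewrite leq_add2r.
Unshelve. all: by end_near.
Qed.

Lemma qf_inv_bounded m : (0 < m)%N -> exists2 B : R, 0 <= B &
  forall n, normc (poch (q ^+ m) (q ^+ m) n)^-1 <= B.
Proof.
move=> m_gt0; have : (fun n => (poch (q ^+ m) (q ^+ m) n)^-1) @ \oo -->
    (qpoch_inf (q ^+ m) (q ^+ m))^-1.
  apply: poch_inv_cvg; first exact: normc_pow_lt1.
  move=> j; rewrite -exprS -exprM; case: m m_gt0 => // m _.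
  by rewrite mulnS addSn q_nonroot.
move/cvgc_bounded => [B bB]; exists B => //.
exact: le_trans (normc_ge0 _) (bB 0%N).
Qed.

(* Termwise, this sum and the Rogers-Szego sum [rogers_szego_sqrt] tend to the same
   series, and the latter has a closed form. *)
Lemma inner_cvg r :
  (fun M => \sum_(u < (M - r).+1)
     (q ^+ u - q ^+ (M.*2.+1 - u)) / (qf u * qf (M.*2.+1 - u))) @ \oo
  --> (qpoch_inf q q)^-1.
Proof.
have t01 : 0 <= normc q < 1 by rewrite normc_ge0.
have [B B0 bB] := qf_inv_bounded (isT : 0 < 2)%N.
have P_cvg : (fun n => (qf n)^-1) @ \oo --> (qpoch_inf p p)^-1.
  apply: poch_inv_cvg; first exact: normc_pow_lt1.
  by move=> j; rewrite -exprS -exprM mulnS addSn q_nonroot.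
have B2 m n : normc (qf m * qf n)^-1 <= B ^+ 2.
  by rewrite invfM normcM expr2 ler_pM ?normc_ge0.
pose g u := q ^+ u * ((qf u)^-1 * (qpoch_inf p p)^-1).
pose f1 N u := q ^+ u / (qf u * qf (N - u)).
(* Extension by zero to the range u <= M that [tannery] requires; for fixed u the guard holds as
   soon as M >= u + r. *)
pose f2 M u := if (u <= M - r)%N then
  (q ^+ u - q ^+ (M.*2.+1 - u)) / (qf u * qf (M.*2.+1 - u)) else 0.
have f1g u : f1^~ u @ \oo --> g u.
  rewrite /f1; under eq_fun do rewrite invfM; apply: cvgM; first exact: cvg_cst.
  apply: cvgM; first exact: cvg_cst.
  by apply: (@cvg_reindex (fun N => N - u)%N u _ _ _ P_cvg) => M; lia.
have f2g u : f2^~ u @ \oo --> g u.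
  pose f2' M := (q ^+ u - q ^+ (M.*2.+1 - u)) / (qf u * qf (M.*2.+1 - u)).
  have lim : f2' @ \oo --> g u.
    rewrite /f2'; under eq_fun do rewrite invfM.
    have -> : g u = (q ^+ u - 0) * ((qf u)^-1 * (qpoch_inf p p)^-1) by rewrite subr0.
    apply: cvgM; last first.
      apply: cvgM; first exact: cvg_cst.
      by apply: (@cvg_reindex (fun N => N.*2.+1 - u)%N u _ _ _ P_cvg) => M; lia.
    apply: cvgB; first exact: cvg_cst.
    apply: (@cvg_reindex (fun N => N.*2.+1 - u)%N u (fun n => q ^+ n)); first by move=> M; lia.
    apply: (@cvgc_squeeze _ _ (fun n => 1 * normc q ^+ n)); last exact: cvg_geometric0.
    by move=> n; rewrite mul1r normcX.
  apply: cvg_trans lim; apply: near_eq_cvg; near=> M; rewrite /f2 /f2' ifT //.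
  have : (u + r <= M)%N by near: M; exact: nbhs_infty_ge.
  lia.
have [S gS f1S] : exists2 S : C, (fun M => \sum_(u < M.+1) g u) @ \oo --> S
    & (fun M => \sum_(u < M.+1) f1 M u) @ \oo --> S.
  apply: (tannery (c := B ^+ 2) t01 _ f1g) => M u.
  by rewrite normcM normcX mulrC ler_wpM2r ?exprn_ge0 ?normc_ge0.
have [S' gS' f2S'] : exists2 S : C, (fun M => \sum_(u < M.+1) g u) @ \oo --> S
    & (fun M => \sum_(u < M.+1) f2 M u) @ \oo --> S.
  apply: (tannery (c := 2 * B ^+ 2) t01 _ f2g) => M u; rewrite /f2.
  case: ifP => le_u; last first.
    by rewrite normc0 !mulr_ge0 ?exprn_ge0 ?normc_ge0.
  rewrite normcM mulrAC ler_pM ?normc_ge0 //.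
  apply: le_trans (ler_normcD _ _) _; rewrite normcNE mulrDl mul1r !normcX lerD2l.
  by rewrite ler_wiXn2l ?normc_ge0 ?ltW //; lia.
rewrite (_ : (fun M => _) = (fun M => \sum_(u < M.+1) f2 M u)); last first.
  apply/funext => M; rewrite /f2 -big_mkcond /=.
  rewrite (big_ord_widen M.+1 (fun u => (q ^+ u - q ^+ (M.*2.+1 - u))
    / (qf u * qf (M.*2.+1 - u)))) ?ltnS ?leq_subr //.
have -> : (qpoch_inf q q)^-1 = S'; last exact: f2S'.
rewrite (cvgc_unique gS' gS); apply: (cvgc_unique _ f1S).
rewrite (_ : (fun M => _) = (fun N => (poch q q N)^-1)).
  by apply: poch_inv_cvg => // j; rewrite -exprS q_nonroot.
by apply/funext => N; rewrite rogers_szego_sqrt //; exact: q_nonroot.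
Unshelve. all: by end_near.
Qed.

Lemma outer_weight_odd M : outer_weight q M.+1 = poch (- q) q M.*2.+1.
Proof.
rewrite /outer_weight doubleS pochSl mulN1r opprK mulrAC -[1 + 1]/(2 : C).
by rewrite divff ?mul1r // pnatr_eq0.
Qed.

Lemma theta_coef_bounded a r : normc (theta_coef p a r) <= 2.
Proof.
case: r => [|r]; first by rewrite normc1 ler1n.
rewrite /theta_coef !normcM (normcX (-1)) normcNE normc1 expr1n mul1r -!exprM.
rewrite -[2]mul1r ler_pM ?normc_ge0 ?normc_pow_le1 //.
by apply: le_trans (ler_normcD _ _) _; rewrite normc1 mulr2n lerD2l normc_pow_le1.
Qed.

(** The factor q^r is the one left by the q-Gauss sum. Completing the exponents gives t = q^(2(k-1))
    and y = q^(2(k-i)-1) in the notation of the theorem, where [a] is k - 1 - i and [i] here is one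
    less than there. *)
Lemma jacobi_coefE a i r :
  jacobi_coef (q ^+ (2 * (a + i.+1))) (q ^+ a.*2.+1) r
  = theta_coef p a r * p ^+ (i * r ^ 2) * q ^+ r.
Proof.
case: r => [|r]; first by rewrite /= muln0 !expr0 !mulr1.
rewrite /jacobi_coef /theta_coef; set n := r.+1.
have le_n : (n <= n ^ 2)%N by rewrite /n; lia.
rewrite -!mulrA; congr (_ * _); rewrite mulrDr mulrDl mul1r mulrDr addrC.
have z m : q ^+ m != 0 by rewrite expf_neq0.
congr (_ + _).
  apply: (mulIf (z (a.*2.+1 * n)%N)); rewrite -!exprM mulfVK //.
  rewrite -!exprD; congr (_ ^+ _).
  by have := subnK le_n; move: (n ^ 2 - n)%N => m <-; lia.
rewrite -!exprM -!exprD; congr (_ ^+ _).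
by have := subnK le_n; move: (n ^ 2 - n)%N => m <-; lia.
Qed.

Lemma jacobi_coef_bounded a i r :
  normc (jacobi_coef (q ^+ (2 * (a + i.+1))) (q ^+ a.*2.+1) r) <= 2 * normc q ^+ r.
Proof.
rewrite jacobi_coefE normcM normcX ler_wpM2r ?exprn_ge0 ?normc_ge0 //.
rewrite normcM -[2]mulr1 ler_pM ?normc_ge0 ?theta_coef_bounded //.
by rewrite -exprM normc_pow_le1.
Qed.

(** The limit of [finite_jacobi]: for fixed r, (s; s)_(2M) times the kernel tends to 1 / (s; s)_oo,
    and multiplying back by (s; s)_oo supplies the third product. *)
Lemma jacobi_triple_product (t y : C) (c : R) : t != 0 -> normc t < 1 -> y != 0 ->
  (forall r, normc (jacobi_coef t y r) <= c * normc q ^+ r) ->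
  (fun M => \sum_(r < M.+1) jacobi_coef t y r) @ \oo -->
  qpoch_inf (y * t) (t ^+ 2) * qpoch_inf (t / y) (t ^+ 2) * qpoch_inf (t ^+ 2) (t ^+ 2).
Proof.
move=> t_neq0 t_lt1 y_neq0 jac_le; have q01 : 0 <= normc q < 1 by rewrite normc_ge0.
have t_nonroot n : t ^+ n.+1 != 1.
  by apply: normc_neq1; rewrite normcX exprn_ilt1 ?normc_ge0.
have s_lt1 : normc (t ^+ 2) < 1 by rewrite normcX exprn_ilt1 ?normc_ge0.
set s := t ^+ 2; set P := qpoch_inf s s.
have s_nonroot n : s * s ^+ n != 1 by rewrite -exprS -exprM mulnS addSn.
have P_neq0 : P != 0 by apply: qpoch_inf_neq0.
have qs_cvg : poch s s @ \oo --> P by apply: poch_cvg.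
have qsV_cvg : (fun n => (poch s s n)^-1) @ \oo --> P^-1 by apply: poch_inv_cvg.
have [B bB] := cvgc_bounded qs_cvg.
have [B' bB'] := cvgc_bounded qsV_cvg.
have B0 : 0 <= B by apply: le_trans (normc_ge0 _) (bB 0%N).
have B'0 : 0 <= B' by apply: le_trans (normc_ge0 _) (bB' 0%N).
pose f M r := jacobi_coef t y r * (poch s s M.*2 * bker s 0 M r).
have f_le M r : normc (f M r) <= c * (B * (B' * B')) * normc q ^+ r.
  rewrite /f normcM mulrAC ler_pM ?normc_ge0 // normcM ler_pM ?normc_ge0 //.
  rewrite /bker /qfVB normcM ler_pM ?normc_ge0 //; case: ifP => // _.
  by rewrite normc0.
have fg r : f^~ r @ \oo --> jacobi_coef t y r * P^-1.
  apply: cvgM; first exact: cvg_cst.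
  have -> : P^-1 = P * (P^-1 * P^-1) by rewrite mulrA divff ?mul1r.
  apply: cvgM; first by apply: (@cvg_reindex _ 0%N _ _ _ qs_cvg) => M; lia.
  apply: cvgM; last by apply: (@cvg_reindex (fun M => M + r + 0)%N 0%N _ _ _ qsV_cvg) => M; lia.
  have lim : (fun M => (poch s s (M - r))^-1) @ \oo --> P^-1.
    by apply: (@cvg_reindex (fun M => M - r)%N r _ _ _ qsV_cvg) => M; lia.
  apply: cvg_trans lim; apply: near_eq_cvg; near=> M; rewrite /qfVB ifT //.
  by near: M; exact: nbhs_infty_ge.
have [S gS fS] := tannery q01 f_le fg.
have Sval : S = qpoch_inf (y * t) s * qpoch_inf (t / y) s.
  apply: (cvgc_unique fS); rewrite (_ : (fun M => _) =
    (fun n => poch (y * t) s n * poch (t / y) s n)).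
    by apply: cvgM; apply: poch_cvg.
  by apply/funext => M; rewrite finite_jacobi // mulr_sumr; apply: eq_bigr => r _; rewrite /f mulrCA.
rewrite -Sval (_ : (fun M => _) =
    (fun M => (\sum_(r < M.+1) jacobi_coef t y r * P^-1) * P)).
  by apply: cvgM; [exact: gS|exact: cvg_cst].
by apply/funext => M; rewrite -mulr_suml mulfVK.
Unshelve. all: by end_near.
Qed.

Lemma main_limit a i m : m = (a + i.+1)%N ->
  (fun M => \sum_(n < M.+1) q ^+ n * outer_weight q n *
     \sum_(s <- chains (i + a) n) chain_term p i n s) @ \oo -->
  qpoch_inf (- q) q
  * (qpoch_inf (q ^+ (2 * m + a.*2.+1)) (q ^+ (4 * m))
     * qpoch_inf (q ^+ (2 * m - a.*2.+1)) (q ^+ (4 * m))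
     * qpoch_inf (q ^+ (4 * m)) (q ^+ (4 * m)))
  / qpoch_inf q q.
Proof.
move=> m_def; have q01 : 0 <= normc q < 1 by rewrite normc_ge0.
have [B B0 bB] := qf_inv_bounded (isT : 0 < 2)%N.
pose t := q ^+ (2 * m); pose y := q ^+ a.*2.+1.
have m_gt0 : (0 < m)%N by rewrite m_def addnS.
have nz k : q ^+ k != 0 by rewrite expf_neq0.
(* By [outer_sum] this is the n-sum times (1 + p^r) / q^r. Since r enters only through the range of
   u, the limit [A] is the same for every r and factors out of the theta series. *)
pose X M r := poch (- q) q M.*2.+1 * \sum_(u < (M - r).+1)
     (q ^+ u - q ^+ (M.*2.+1 - u)) / (qf u * qf (M.*2.+1 - u)).
pose A := qpoch_inf (- q) q / qpoch_inf q q.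
have X_cvg r : X^~ r @ \oo --> A.
  apply: cvgM; last exact: inner_cvg.
  have lim : poch (- q) q @ \oo --> qpoch_inf (- q) q by exact: poch_cvg.
  by apply: (@cvg_reindex (fun M => M.*2.+1) 0%N _ _ _ lim) => M; lia.
set E := expR (normc (- q) / (1 - normc q)).
pose D := E * (2 * B ^+ 2 / (1 - normc q)).
have X_le M r : normc (X M r) <= D.
  rewrite normcM ler_pM ?normc_ge0 ?poch_bounded //.
  apply: le_trans (normc_sum _ _ _) _.
  apply: (@le_trans _ _ (\sum_(u < (M - r).+1) 2 * B ^+ 2 * normc q ^+ u)).
    apply: ler_sum => u _; rewrite normcM mulrAC ler_pM ?normc_ge0 //; last first.
      by rewrite invfM normcM expr2 ler_pM ?normc_ge0.
    apply: le_trans (ler_normcD _ _) _; rewrite normcNE mulrDl mul1r !normcX lerD2l.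
    by rewrite ler_wiXn2l ?normc_ge0 ?ltW //; have := ltn_ord u; lia.
  rewrite -mulr_sumr ler_wpM2l ?geometric_sum_le //.
  by rewrite mulr_ge0 ?exprn_ge0.
have [S gS fS] : exists2 S : C,
    (fun M => \sum_(r < M.+1) jacobi_coef t y r * A) @ \oo --> S
  & (fun M => \sum_(r < M.+1) jacobi_coef t y r * X M r) @ \oo --> S.
  apply: (@tannery _ (fun M r => jacobi_coef t y r * X M r)
    (fun r => jacobi_coef t y r * A) (2 * D) _ q01) => [M r|r].
    by rewrite normcM mulrAC ler_pM ?normc_ge0 // /t m_def jacobi_coef_bounded.
  by apply: cvgM; [exact: cvg_cst|exact: X_cvg].
have jac_le r : normc (jacobi_coef t y r) <= 2 * normc q ^+ r.
  by rewrite /t m_def jacobi_coef_bounded.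
have theta := @jacobi_triple_product t y 2 (nz _) _ (nz _) jac_le.
have Sval : S = qpoch_inf (y * t) (t ^+ 2) * qpoch_inf (t / y) (t ^+ 2)
    * qpoch_inf (t ^+ 2) (t ^+ 2) * A.
  apply: (cvgc_unique gS); rewrite (_ : (fun M => _) =
    (fun M => (\sum_(r < M.+1) jacobi_coef t y r) * A)).
    apply: cvgM; last exact: cvg_cst.
    by apply: theta; rewrite normc_pow_lt1 // muln_gt0.
  by apply/funext => M; rewrite -mulr_suml.
have e1 : y * t = q ^+ (2 * m + a.*2.+1) by rewrite mulrC -exprD.
have e2 : t / y = q ^+ (2 * m - a.*2.+1) by rewrite -expfB_cond //; lia.
have e3 : t ^+ 2 = q ^+ (4 * m) by rewrite -exprM; congr (_ ^+ _); lia.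
rewrite e1 e2 e3 in Sval; rewrite mulrAC -/A mulrC -Sval.
rewrite (_ : (fun M => _) = (fun M => \sum_(r < M.+1) jacobi_coef t y r * X M r)) //.
apply/funext => M.
(* The kernel is zero for r > n, so r can run to M for every n and the two finite sums can be
   exchanged. *)
transitivity (\sum_(n < M.+1) \sum_(r < M.+1) theta_coef p a r * p ^+ (i * r ^ 2)
   * ((1 + p ^+ r) * (q ^+ n * outer_weight q n * bker p 0 n r))).
  apply: eq_bigr => n _; rewrite chain_term_sum; last 2 first.
  - exact: sqr_neq0.
  - exact/sqr_nonroot/q_nonroot.
  rewrite (bker_widen p 0 (fun r => (1 + p ^+ r) * (theta_coef p a r * p ^+ (i * r ^ 2)))
    (leq_ord n)).
  by rewrite mulr_sumr; apply: eq_bigr => r _; ring.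
rewrite exchange_big; apply: eq_bigr => r _ /=.
rewrite -!mulr_sumr outer_sum ?sqr_nonroot //; last 2 first.
- exact: q_nonroot.
- by rewrite -ltnS.
by rewrite outer_weight_odd [LHS]mulrA -jacobi_coefE -m_def.
Qed.

End MainLimit.

(** * Summation over chains *)

(** Absolute boundedness along the exhaustion makes convergence unconditional: a finite set J
    containing some A M0 lies in a later A M, so its excess over A M0 is at most the tail of the
    absolute sums. *)
Lemma has_sum_exhaust (R : realType) (C := (complex R : numFieldType)) (I : choiceType)
    (f : I -> C) (A : nat -> seq I) (l : C) (B : R) :
  (forall M, uniq (A M)) -> (forall M N, (M <= N)%N -> {subset A M <= A N}) ->
  (forall x, exists M, x \in A M) ->
  (forall M, \sum_(x <- A M) normc (f x) <= B) ->
  (fun M => \sum_(x <- A M) f x) @ \oo --> l ->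
  has_sum f l.
Proof.
move=> uniqA monoA exhA boundA limA.
pose s M := \sum_(x <- A M) normc (f x).
have s_split M (J : seq I) (T : zmodType) (h : I -> T) : uniq J ->
    {subset A M <= J} ->
    \sum_(x <- J) h x = \sum_(x <- A M) h x + \sum_(x <- J | x \notin A M) h x.
  move=> uniqJ AJ; rewrite (bigID (fun x => x \in A M)) /=; congr (_ + _).
  rewrite -big_filter; apply: perm_big; apply: uniq_perm; rewrite ?filter_uniq //.
  by move=> x; rewrite mem_filter; case: (boolP (x \in A M)) => //= /AJ.
have s_mono : nondecreasing_seq s.
  move=> M N le_MN; rewrite /s (s_split M (A N)) //; last exact: monoA.
  by rewrite lerDl sumr_ge0 // => x _; exact: normc_ge0.
have s_cvg : cvgn s.
  by apply: nondecreasing_is_cvgn => //; exists B => _ [M _ <-]; exact: boundA.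
have totF : Filter (@totally I) := @filter_filter _ _ (@totally_filter I).
apply/cvgrPdist_lt => e e_gt0.
have /complex_realP[r er] : e \is Num.real by rewrite gtr0_real.
move: e_gt0; rewrite er ltcR => r_gt0.
have r2 : 0 < r / 2 by rewrite divr_gt0.
move/cvgcP/cvgrPdist_lt: limA => /(_ _ r2)[N1 _ lim1].
move/cvgrPdist_lt: (s_cvg) => /(_ _ r2)[N2 _ lim2].
pose M0 := maxn N1 N2.
have := lim1 M0 (leq_maxl _ _); have := lim2 M0 (leq_maxr _ _).
rewrite /= sub0r normrN (ger0_norm (normc_ge0 _)) => tail head.
exists [fset x in A M0]%fset => // J /= /fsubsetP subJ.
have AJ : {subset A M0 <= enum_fset J} by move=> x xA; apply: subJ; rewrite inE.
have [M [le_M JA]] : exists M, (M0 <= M)%N /\ {subset enum_fset J <= A M}.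
  elim: (enum_fset J) => [|x J' [M [le_M sub]]]; first by exists M0.
  have [M' xM'] := exhA x; exists (maxn M M'); split; first by rewrite leq_max le_M.
  move=> y; rewrite inE => /predU1P[->|/sub yM].
    by apply: monoA xM'; exact: leq_maxr.
  by apply: monoA yM; exact: leq_maxl.
rewrite normc_real ltcR normc_distC /partial_sum -(big_seq_fsetE _ _ predT f) /=.
rewrite (s_split M0 (enum_fset J)) ?fset_uniq // addrAC.
apply: le_lt_trans (ler_normcD _ _) _; rewrite (splitr r) ltr_leD //.
apply: le_trans (normc_sum _ _ _) _; apply: le_trans (ltW tail).
apply: (@le_trans _ _ (s M - s M0)).
  rewrite /s (s_split M0 (A M)) //; last exact: monoA.
  rewrite addrAC subrr add0r -big_filter -[leRHS]big_filter.
  have sub : {subset [seq x <- enum_fset J | x \notin A M0]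
      <= [seq x <- A M | x \notin A M0]}.
    by move=> x; rewrite !mem_filter => /andP[-> /JA].
  have perm : perm_eq [seq x <- enum_fset J | x \notin A M0]
      [seq x <- [seq x <- A M | x \notin A M0]
         | x \in [seq x <- enum_fset J | x \notin A M0]].
    apply: uniq_perm; rewrite ?filter_uniq ?fset_uniq // => x.
    by rewrite [RHS]mem_filter; apply/idP/andP => [xJ|[]//]; split=> //; exact: sub.
  rewrite (perm_big _ perm) /= big_filter.
  rewrite [leRHS](bigID (fun x => x \in [seq x <- enum_fset J | x \notin A M0])) /=.
  by rewrite lerDl sumr_ge0 // => x _; exact: normc_ge0.
have le_lim n : s n <= limn s by exact: (nondecreasing_cvgn_le s_mono s_cvg).
rewrite ger0_norm ?subr_ge0; last by [].
by rewrite lerD2r.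
Qed.

Section Chains.
Variable m : nat.

Definition chain_of_seq (s : seq nat) : option (chain m) := obind insub (insub s).

Lemma chain_of_seqK : ocancel chain_of_seq (fun N : chain m => tval (val N)).
Proof.
move=> s; rewrite /chain_of_seq; case: insubP => //= t _ <-.
by case: insubP => //= N _ <-.
Qed.

Lemma tval_chainK (N : chain m) : chain_of_seq (tval (val N)) = Some N.
Proof. by rewrite /chain_of_seq !valK /= valK. Qed.

Definition chain_enum M : seq (chain m) := pmap chain_of_seq (chains m M).

Lemma chain_enum_uniq M : uniq (chain_enum M).
Proof. exact: (pmap_uniq chain_of_seqK (chains_uniq m M)). Qed.

Lemma mem_chain_enum (N : chain m) M : (N \in chain_enum M) = path geq M (tval (val N)).
Proof.
rewrite mem_pmap -tval_chainK; apply/mapP/idP => [[s]|pN].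
  rewrite mem_chains => /andP[_ ps] e.
  have := chain_of_seqK s; rewrite -e tval_chainK /= => ->.
  exact: ps.
by exists (tval (val N)) => //; rewrite mem_chains size_tuple eqxx.
Qed.

Lemma big_chain_enum (T : nmodType) (G : seq nat -> T) M :
  \sum_(N <- chain_enum M) G (tval (val N)) = \sum_(s <- chains m M) G s.
Proof.
rewrite big_pmap big_seq [RHS]big_seq; apply: eq_bigr => s.
rewrite mem_chains => /andP[sz ps].
have sorted_s : sorted geq s by case: s ps {sz} => //= n s /andP[].
by rewrite /chain_of_seq insubT /= insubT.
Qed.

End Chains.

(** * Rewriting the summand, and its absolute summability *)

Section Summand.
Variables (R : realType) (q : (complex R : numFieldType)).
Hypothesis q_neq0 : q != 0.
Hypothesis q_lt1 : normc q < 1.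
Local Notation C := (complex R : numFieldType).
Local Notation p := (q ^+ 2).
Local Notation qf := (poch p p).

Lemma qpoch_pow m n : (0 < m)%N ->
  qpoch (q ^+ m) (q ^+ m) n%:Z = poch (q ^+ m) (q ^+ m) n.
Proof.
move=> m_gt0; apply: qpoch_nat; first exact: normc_pow_lt1.
move=> j; rewrite -exprS -exprM; case: m m_gt0 => // m _.
by rewrite mulSn addSn q_nonroot.
Qed.

Lemma opp_pow_neq1 n : - q ^+ n != 1.
Proof.
case: n => [|n]; last by apply: normc_neq1; rewrite normcNE normc_pow_lt1.
by rewrite expr0 eq_sym -addr_eq0 -(natrD _ 1 1) pnatr_eq0.
Qed.

(** For positive n, [poch_rev] turns both factors into products with initial terms -p and -q, which
    interlace to (-q; q)_(2n-1) by [poch_sqr_split]. The negative powers of p so released cancel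
    q^(2 n^2) exactly, leaving q^n. *)
Lemma outer_factor n :
  qpoch (- q ^ (2 - 2 * n%:Z)) p (n%:Z - 1) * qpoch (- q ^ (1 - 2 * n%:Z)) p n%:Z
    * q ^+ (2 * n ^ 2)
  = q ^+ n * outer_weight q n.
Proof.
have p_lt1 : normc p < 1 by exact: normc_pow_lt1.
have p_neq0 : p != 0 by exact: sqr_neq0.
have z k : q ^+ k != 0 by rewrite expf_neq0.
case: n => [|n].
  rewrite !mulr0 !subr0 !expr0 !mulr1 mul1r qpoch_nat //; last first.
    by move=> j; rewrite add0n -exprM mulNr -exprnP -exprS opp_pow_neq1.
  rewrite poch0 mulr1 /outer_weight poch0 /qpoch sub0r.
  (* At n = 0 the index is -1, and the quotient (-q^2; q^2)_oo / (-1; q^2)_oo is 1/2, matching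
     [outer_weight] at 0. *)
  have -> : - q ^ 2 * p ^ (-1) = -1 by rewrite -exprnP mulNr -exprnN expr1 divff.
  rewrite (qpoch_inf_shift (-1) 1 p_lt1) pochS poch0 expr0 expr1 !mulN1r !mul1r.
  rewrite opprK -exprnP -[1 + 1]/(2 : C); set P := qpoch_inf _ _.
  have P_neq0 : P != 0.
    by apply: qpoch_inf_neq0 => // j; rewrite mulNr -exprS -exprM opp_pow_neq1.
  by field; rewrite P_neq0 ?pnatr_eq0.
have e1 : - q ^ (2 - 2 * n.+1%:Z) = - 1 / p ^+ n.
  rewrite mulNr mul1r -exprM exprnN; congr (- (_ ^ _)); lia.
have e2 : - q ^ (1 - 2 * n.+1%:Z) = - q / p ^+ n.+1.
  rewrite mulNr -exprM exprnN -[X in _ = - (X * _)]expr1z -expfzDr //; congr (- (_ ^ _)); lia.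
have e3 : (n.+1%:Z - 1 = n)%R by lia.
rewrite e1 e2 e3 qpoch_nat //; last first.
  move=> j; rewrite exprD mulrA divfK ?expf_neq0 // mulN1r -exprM.
  exact: opp_pow_neq1.
rewrite qpoch_nat //; last first.
  move=> j; rewrite exprD mulrA divfK ?expf_neq0 // mulNr -exprM -exprS.
  exact: opp_pow_neq1.
rewrite poch_rev ?oppr_eq0 ?oner_eq0 // poch_rev ?oppr_eq0 //.
rewrite outer_weight_odd poch_sqr_split opprK expr1n invrN invr1 mulrN1.
have -> : p / - q = - q by rewrite invrN mulrN expr2 mulfK.
have -> : - q * q = - p by rewrite mulNr -expr2.
have E : q ^+ (2 * n.+1 ^ 2) = p ^+ 'C(n.+1, 2) * p ^+ 'C(n.+2, 2).
  rewrite -!exprM -exprD; congr (_ ^+ _).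
  have tri u : (2 * 'C(u, 2) + u = u ^ 2)%N.
    by elim: u => [//|u IH]; rewrite binS bin1; lia.
  by have := tri n.+1; have := tri n.+2; lia.
rewrite E opprK; field.
by rewrite !expf_neq0.
Qed.

Lemma summandE (i n : nat) (s : seq nat) (S := (n :: s)) : path geq n s -> (i <= size s)%N ->
  qpoch (- q ^ (2 - 2 * n%:Z)) p (n%:Z - 1) * qpoch (- q ^ (1 - 2 * n%:Z)) p n%:Z
  * q ^+ (2 * (\sum_(0 <= j < (size s).+1) nth 0%N S j ^ 2
               + \sum_(i.+1 <= j < (size s).+1) nth 0%N S j))%N
  * (1 + q ^+ (2 * nth 0%N S i))
  / (\prod_(0 <= j < size s) qpoch p p ((nth 0%N S j)%:Z - (nth 0%N S j.+1)%:Z)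
     * qpoch (q ^+ 4) (q ^+ 4) (nth 0%N S (size s))%:Z)
  = q ^+ n * outer_weight q n * chain_term p i n s.
Proof.
move=> ps le_i; rewrite -outer_factor chain_termE //.
have -> : \prod_(0 <= j < size s) qpoch p p ((nth 0%N S j)%:Z - (nth 0%N S j.+1)%:Z)
    = \prod_(0 <= j < size s) qf (nth 0%N S j - nth 0%N s j).
  apply: eq_big_nat => j /andP[_ lt_j]; rewrite subzn ?qpoch_pow //.
  by have /(pathP 0%N)/(_ j lt_j) := ps.
rewrite qpoch_pow // (big_nat_recl _ 0) // big_add1 /= (last_nth 0%N).
have -> : q ^+ 4 = (q ^+ 2) ^+ 2 by rewrite -exprM.
rewrite -addnA mulnDr (exprD q (2 * n ^ 2)) -!exprM.
ring.
Qed.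

(** Since e m >= m, a head entry m costs at most K |q|^m, with K bounding the inverse Pochhammer
    symbols. Summing over the head gives a bound independent of n. *)
Lemma weighted_chains_bounded (w : nat -> seq nat -> C) (w' : nat -> seq nat -> C)
    (e : nat -> nat) (b : nat) :
  (forall m, (m <= e m)%N) ->
  (forall n m s, w' n (m :: s) = p ^+ e m / qf (n - m) * w m s) ->
  (exists B, forall n, \sum_(s <- chains b n) normc (w n s) <= B) ->
  exists B, forall n, \sum_(s <- chains b.+1 n) normc (w' n s) <= B.
Proof.
move=> le_e w'E [B wB]; have q01 : 0 <= normc q < 1 by rewrite normc_ge0.
have [K K0 qfK] := qf_inv_bounded q_lt1 (isT : 0 < 2)%N.
have B0 : 0 <= B.
  by apply: le_trans (wB 0%N); rewrite sumr_ge0 // => s _; exact: normc_ge0.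
exists (K * B / (1 - normc q)) => n; rewrite big_chainsS.
apply: (@le_trans _ _ (\sum_(m < n.+1) K * B * normc q ^+ m)).
  apply: ler_sum => m _; under eq_bigr do rewrite w'E normcM.
  rewrite -mulr_sumr mulrAC ler_pM ?normc_ge0 //.
    by rewrite sumr_ge0 // => s _; exact: normc_ge0.
  rewrite normcM mulrC ler_pM ?normc_ge0 // -exprM normcX.
  by rewrite ler_wiXn2l ?normc_ge0 ?ltW //; have := le_e m; lia.
by rewrite -mulr_sumr ler_wpM2l ?mulr_ge0 ?geometric_sum_le.
Qed.

Lemma chain_term_bounded a i :
  exists B, forall n, \sum_(s <- chains (i + a) n) normc (chain_term p i n s) <= B.
Proof.
elim: i => [|i IH]; last first.
  by apply: (weighted_chains_bounded (e := fun m => m ^ 2)%N) IH => // m; nia.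
have [B Btail] : exists B, forall n,
    \sum_(s <- chains a n) normc (chain_tail p n s) <= B.
  elim: a => [|a IH]; last first.
    by apply: (weighted_chains_bounded (e := fun m => m ^ 2 + m)%N) IH => // m; lia.
  have [K _ K4] := qf_inv_bounded q_lt1 (isT : 0 < 4)%N.
  by exists K => n; rewrite big_seq1 /= -exprM.
exists (2 * B) => n; under eq_bigr do rewrite /= normcM.
rewrite -mulr_sumr ler_pM ?normc_ge0 //.
  by rewrite sumr_ge0 // => s _; exact: normc_ge0.
apply: le_trans (ler_normcD _ _) _.
by rewrite normc1 -[2]/(1 + 1) lerD2l -exprM normc_pow_le1.
Qed.

Lemma chain_sum_bounded a i : exists B, forall M,
  \sum_(n < M.+1) normc (q ^+ n * outer_weight q n)
     * (\sum_(s <- chains (i + a) n) normc (chain_term p i n s)) <= B.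
Proof.
have q01 : 0 <= normc q < 1 by rewrite normc_ge0.
have [B leB] := chain_term_bounded a i.
have B0 : 0 <= B.
  by apply: le_trans (leB 0%N); rewrite sumr_ge0 // => s _; exact: normc_ge0.
set E := expR (normc (-1) / (1 - normc q)) * normc 2^-1.
have E0 : 0 <= E by rewrite mulr_ge0 ?normc_ge0 ?expR_ge0.
exists (E * B / (1 - normc q)) => M.
apply: (@le_trans _ _ (\sum_(n < M.+1) E * B * normc q ^+ n)).
  apply: ler_sum => n _; rewrite mulrAC ler_pM ?normc_ge0 //.
    by rewrite sumr_ge0 // => s _; exact: normc_ge0.
  rewrite normcM normcX mulrC ler_wpM2r ?exprn_ge0 ?normc_ge0 //.
  by rewrite /outer_weight normcM ler_wpM2r ?normc_ge0 // poch_bounded.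
have EB0 : 0 <= E * B by exact: mulr_ge0.
by rewrite -mulr_sumr ler_wpM2l ?geometric_sum_le.
Qed.

End Summand.

Theorem theorem1p13 (R : realType) (q : complex R) (k i : nat)
    (q_neq0 : q != 0) (q_lt1 : `|q| < 1)
    (i_ge1 : (1 <= i)%N) (i_ltk : (i < k)%N) :
  has_sum
    (fun N : chain k.-1 =>
       qpoch (- q ^ (2 - 2 * (part N 1)%:Z)) (q ^+ 2) ((part N 1)%:Z - 1)
       * qpoch (- q ^ (1 - 2 * (part N 1)%:Z)) (q ^+ 2) (part N 1)%:Z
       * q ^+ (2 * (\sum_(1 <= j < k) part N j ^ 2
                    + \sum_(i.+1 <= j < k) part N j))%N
       * (1 + q ^+ (2 * part N i)%N)
       / ((\prod_(1 <= j < k.-1)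
             qpoch (q ^+ 2) (q ^+ 2) ((part N j)%:Z - (part N j.+1)%:Z))
          * qpoch (q ^+ 4) (q ^+ 4) (part N k.-1)%:Z))
    (qpoch_inf (- q) q
     * (qpoch_inf (q ^+ (2 * i - 1)%N) (q ^+ (4 * k - 4)%N)
        * qpoch_inf (q ^+ (4 * k - 3 - 2 * i)%N) (q ^+ (4 * k - 4)%N)
        * qpoch_inf (q ^+ (4 * k - 4)%N) (q ^+ (4 * k - 4)%N))
     / qpoch_inf q q).
Proof.
have q_lt1' : normc q < 1 by rewrite -ltcR.
(* Of the k - 2 entries after N_1, the first i' = i - 1 reach N_i with weights p^(m^2); the other a
   = k - 1 - i carry p^(m^2 + m). *)
have [a [i' [e_i e_k]]] : exists a i', i = i'.+1 /\ k = (i' + a).+2.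
  by exists (k - i.+1)%N, i.-1; split; lia.
subst i k; rewrite [(_.+2).-1]/=; set m := (i' + a)%N.
pose term n s : (complex R : numFieldType) :=
  q ^+ n * outer_weight q n * chain_term (q ^+ 2) i' n s.
pose F s := term (head 0%N s) (behead s).
have FE (N : chain m.+1) :
       qpoch (- q ^ (2 - 2 * (part N 1)%:Z)) (q ^+ 2) ((part N 1)%:Z - 1)
       * qpoch (- q ^ (1 - 2 * (part N 1)%:Z)) (q ^+ 2) (part N 1)%:Z
       * q ^+ (2 * (\sum_(1 <= j < m.+2) part N j ^ 2
                    + \sum_(i'.+2 <= j < m.+2) part N j))%N
       * (1 + q ^+ (2 * part N i'.+1)%N)
       / ((\prod_(1 <= j < m.+1)
             qpoch (q ^+ 2) (q ^+ 2) ((part N j)%:Z - (part N j.+1)%:Z))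
          * qpoch (q ^+ 4) (q ^+ 4) (part N m.+1)%:Z) = F (tval (val N)).
  have := valP N; have := size_tuple (val N); rewrite /part /F.
  case: (tval (val N)) => [//|n s] [sz] ps.
  have le_i : (i' <= size s)%N by rewrite sz leq_addr.
  have := @summandE R q q_neq0 q_lt1' i' n s ps le_i; rewrite sz big_add1 => E.
  by rewrite !big_add1; exact: E.
have [B leB] := chain_sum_bounded q_neq0 q_lt1' a i'.
(* The exhaustion is by the size of the largest part, N_1 <= M, the same cut as in [main_limit]. *)
apply: (@has_sum_exhaust R _ _ (@chain_enum m.+1) _ B).
- exact: chain_enum_uniq.
- move=> M N le_MN x; rewrite !mem_chain_enum; case: (tval (val x)) => //= n s.
  by move=> /andP[le_n ->]; rewrite (leq_trans le_n).
- move=> x; exists (head 0%N (tval (val x))); rewrite mem_chain_enum.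
  have := valP x; case: (tval (val x)) => //= n s ->.
  by rewrite leqnn.
- move=> M; under eq_bigr do rewrite FE.
  rewrite (big_chain_enum _ (fun s => normc (F s))) big_chainsS.
  apply: le_trans (leB M); apply: ler_sum => n _.
  by rewrite mulr_sumr; apply: ler_sum => s _; rewrite /F /term normcM.
have lim := @main_limit R q q_neq0 q_lt1' a i' _ erefl.
have e1 : (2 * (a + i'.+1) + a.*2.+1 = 4 * m.+2 - 3 - 2 * i'.+1)%N by rewrite /m; lia.
have e2 : (2 * (a + i'.+1) - a.*2.+1 = 2 * i'.+1 - 1)%N by lia.
have e3 : (4 * (a + i'.+1) = 4 * m.+2 - 4)%N by rewrite /m; lia.
move: lim; rewrite e1 e2 e3 [X in _ * (X * _) / _]mulrC => lim.
rewrite (_ : (fun M => _) = (fun M => \sum_(n < M.+1) q ^+ n * outer_weight q n *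
  \sum_(s <- chains (i' + a) n) chain_term (q ^+ 2) i' n s)); first exact: lim.
apply/funext => M; under eq_bigr do rewrite FE.
rewrite (big_chain_enum _ F) big_chainsS; apply: eq_bigr => n _.
by rewrite mulr_sumr; apply: eq_bigr.
Qed.
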